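(* Let $k$ be an algebraically closed field, $Q=(I,A)$ a finite quiver and $G\subseteq\mathrm{Aut}(Q)$ a finite group with $\mathrm{char}\,k\nmid|G|$. Suppose $\lambda=(\lambda_i)_{i\in I}\in k^I$ satisfies $\lambda_i=\lambda_j$ for any $i,j\in I$ in the same $G$-orbit, and let $i\in I$ be a loop-free vertex with $\lambda_i\neq0$. If $G$ is abelian and the action of $G$ on $Q$ is admissible, then there is an equivalence of categories $$F_i:\Pi_Q^\lambda G\text{-}\mathbf{mod}\longrightarrow \Pi_Q^{d_{\mathcal O_i}\lambda}G\text{-}\mathbf{mod}$$ that acts as the reflection $r_{\mathcal O_i}$ on dimension vectors.
   Context: For an arrow $a$, $h(a)$ and $t(a)$ are its head and tail. The double quiver $\overline Q$ is obtained from $Q$ by adding an arrow $a':j\to i$ for each arrow $a:i\to j$ of $Q$. For $\lambda\in k^I$, the deformed preprojective algebra is $\Pi_Q^\lambda=k\overline Q/\mathcal I$, where $\mathcal I$ is the ideal generated by $\sum_{a\in A,\,h(a)=i}aa'-\sum_{a\in A,\,t(a)=i}a'a-\lambda_ie_i$ for $i\in I$ ($e_i$ the primitive idempotent at $i$). $G$ acts on $\overline Q$ by $g(a')=g(a)'$, and if $\lambda$ is constant on $G$-orbits then $G$ acts on $\Pi_Q^\lambda$ by automorphisms. For an algebra $\Lambda$ with $G$-action, the skew group algebra $\Lambda G$ is spanned by elements $ga$ ($g\in G,a\in\Lambda$; underlying space $kG\otimes_k\Lambda$) with $ga\cdot hb=gh\,h^{-1}(a)\,b$. $\Lambda\text{-}\mathbf{mod}$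 is the category of finite dimensional modules. The dimension vector of a $\Pi_Q^\lambda G$-module $V$ is $(\dim_k e_iV)_{i\in I}$. A vertex $i$ is loop-free if there is no arrow $i\to i$. The action of $G$ on $Q$ is admissible if $Q$ has no arrows connecting two vertices in the same $G$-orbit. $\mathcal O_i$ is the $G$-orbit of $i$. On $\mathbb Z^I$ put $\langle\alpha,\beta\rangle=\sum_{i\in I}\alpha_i\beta_i-\sum_{a\in A}\alpha_{t(a)}\beta_{h(a)}$ and $(\alpha,\beta)=\langle\alpha,\beta\rangle+\langle\beta,\alpha\rangle$; let $\varepsilon_i$ be the coordinate vector at $i$. For a loop-free vertex $i$: $r_i(\alpha)=\alpha-(\alpha,\varepsilon_i)\varepsilon_i$ on $\mathbb Z^I$, and $d_i:k^I\to k^I$, $(d_i\lambda)_j=\lambda_j-(\varepsilon_i,\varepsilon_j)\lambda_i$. When the action is admissible, $r_{\mathcal O_i}=\prod_{j\in\mathcal O_i}r_j$ and $d_{\mathcal O_i}=\prod_{j\in\mathcal O_i}d_j$ (the factors commute). *)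

(* Defs.v *)
From HB Require Import structures.
From mathcomp Require Import all_boot all_order all_algebra all_fingroup.
From mathcomp Require Import boolp.
From mathcomp Require Import finmap monalg.

Set Implicit Arguments.
Unset Strict Implicit.
Unset Printing Implicit Defensive.

Import GRing.Theory.
Local Open Scope ring_scope.

(* Associative unital algebras over a field.  MathComp's algType requires     *)
(* 1 != 0, whereas a deformed preprojective algebra may be the zero algebra.  *)

HB.mixin Record Lmodule_isAssocAlg (k : fieldType) A of GRing.Lmodule k A := {
  amul : A -> A -> A;
  aone : A;
  amulA : associative amul;
  amul1l : left_id aone amul;
  amul1r : right_id aone amul;
  amul_linl : forall y, linear (fun x => amul x y);
  amul_linr : forall x, linear (amul x)
}.

#[short(type="assocAlgType")]
HB.structure Definition AssocAlg (k : fieldType) :=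
  {A of Lmodule_isAssocAlg k A & GRing.Lmodule k A}.

Arguments aone {k s}.

Notation "x ** y" := (amul x y) (at level 40, left associativity) : ring_scope.

Section AlgebraTheory.
Variables (k : fieldType) (A : assocAlgType k).
Implicit Types (x y z : A) (c : k).

Lemma amulDl x y z : (x + y) ** z = x ** z + y ** z.
Proof. by have := amul_linl z 1 x y; rewrite !scale1r. Qed.
Lemma amulDr x y z : z ** (x + y) = z ** x + z ** y.
Proof. by have := amul_linr z 1 x y; rewrite !scale1r. Qed.
Lemma amul0l x : 0 ** x = 0.
Proof. by apply: (addIr (0 ** x)); rewrite -amulDl !add0r. Qed.
Lemma amul0r x : x ** 0 = 0.
Proof. by apply: (addIr (x ** 0)); rewrite -amulDr !add0r. Qed.
Lemma amulZl c x y : (c *: x) ** y = c *: (x ** y).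
Proof. by have := amul_linl y c x 0; rewrite amul0l !addr0. Qed.
Lemma amulZr c x y : x ** (c *: y) = c *: (x ** y).
Proof. by have := amul_linr x c y 0; rewrite amul0r !addr0. Qed.
Lemma amulNl x y : (- x) ** y = - (x ** y).
Proof. by rewrite -scaleN1r amulZl scaleN1r. Qed.
Lemma amulNr x y : x ** (- y) = - (x ** y).
Proof. by rewrite -scaleN1r amulZr scaleN1r. Qed.
Lemma amulBl x y z : (x - y) ** z = x ** z - y ** z.
Proof. by rewrite amulDl amulNl. Qed.
Lemma amulBr x y z : z ** (x - y) = z ** x - z ** y.
Proof. by rewrite amulDr amulNr. Qed.
Lemma amul_suml (I : Type) (r : seq I) (P : pred I) (F : I -> A) y :
  (\sum_(i <- r | P i) F i) ** y = \sum_(i <- r | P i) F i ** y.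
Proof.
by apply: (big_morph (amul^~ y)) => [a b|]; rewrite ?amul0l ?amulDl.
Qed.
Lemma amul_sumr (I : Type) (r : seq I) (P : pred I) (F : I -> A) x :
  x ** (\sum_(i <- r | P i) F i) = \sum_(i <- r | P i) x ** F i.
Proof. by apply: (big_morph (amul x)) => [a b|]; rewrite ?amul0r ?amulDr. Qed.

End AlgebraTheory.

Section LinearSum.
Variables (k : fieldType) (U V : lmodType k) (f : U -> V).
Hypothesis lf : linear f.

Lemma lin0 : f 0 = 0.
Proof. by have := lf (-1) 0 0; rewrite !scaleN1r !addNr. Qed.
Lemma linD x y : f (x + y) = f x + f y.
Proof. by have := lf 1 x y; rewrite !scale1r. Qed.
Lemma linZ c x : f (c *: x) = c *: f x.
Proof. by have := lf c x 0; rewrite lin0 !addr0. Qed.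
Lemma linB x y : f (x - y) = f x - f y.
Proof. by rewrite linD -scaleN1r linZ scaleN1r. Qed.
Lemma lin_sum (I : Type) (r : seq I) (P : pred I) (F : I -> U) :
  f (\sum_(i <- r | P i) F i) = \sum_(i <- r | P i) f (F i).
Proof. by apply: (big_morph f) => [a b|]; rewrite ?lin0 ?linD. Qed.

Lemma lin_comp (W : lmodType k) (g : V -> W) : linear g -> linear (g \o f).
Proof. by move=> lg c x y; rewrite /= lf lg. Qed.

End LinearSum.

(* ideal_gen S is the two-sided ideal generated by S (closure under scalars   *)
(* is ideal_genZ).                                                            *)

Inductive ideal_gen (k : fieldType) (A : assocAlgType k) (S : A -> Prop) :
    A -> Prop :=
| Ideal_gen s of S s : ideal_gen S s
| Ideal0 : ideal_gen S 0
| IdealB x y of ideal_gen S x & ideal_gen S y : ideal_gen S (x - y)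
| IdealMl a x of ideal_gen S x : ideal_gen S (a ** x)
| IdealMr a x of ideal_gen S x : ideal_gen S (x ** a).

Section Quotient.
Variables (k : fieldType) (A : assocAlgType k) (S : A -> Prop).

Definition ideal_pred : {pred A} := fun x => `[< ideal_gen S x >].

Lemma ideal_predP x : reflect (ideal_gen S x) (x \in ideal_pred).
Proof. exact: asboolP. Qed.

Lemma ideal_pred_zmod_closed : zmod_closed ideal_pred.
Proof.
split=> [|x y /ideal_predP Ix /ideal_predP Iy]; apply/ideal_predP.
  exact: Ideal0.
exact: IdealB.
Qed.

HB.instance Definition _ :=
  GRing.isZmodClosed.Build A ideal_pred ideal_pred_zmod_closed.

Definition ideal_zmod : zmodClosed A := ideal_pred.
Definition quot_alg : Type := Quotient.quot ideal_zmod.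
HB.instance Definition _ := GRing.Zmodule.on quot_alg.

Definition quot_proj (x : A) : quot_alg := \pi_(Quotient.quot ideal_zmod)%qT x.

Lemma quot_projP x y : reflect (ideal_gen S (x - y))
                               (quot_proj x == quot_proj y).
Proof. by rewrite /quot_proj -Quotient.idealrBE; apply: ideal_predP. Qed.

Lemma quot_proj_eq x y : ideal_gen S (x - y) -> quot_proj x = quot_proj y.
Proof. by move=> I; apply/eqP/quot_projP. Qed.

Definition quot_lift (x : quot_alg) : A :=
  generic_quotient.repr (x : Quotient.quot ideal_zmod).

Lemma quot_liftK : cancel quot_lift quot_proj.
Proof. by move=> x; rewrite /quot_proj /quot_lift reprK. Qed.

Lemma quot_lift_ideal x : ideal_gen S (quot_lift (quot_proj x) - x).
Proof. by apply/quot_projP; rewrite quot_liftK. Qed.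

Lemma quot_projD x y : quot_proj (x + y) = quot_proj x + quot_proj y.
Proof. exact: raddfD. Qed.

Lemma ideal_genZ c x : ideal_gen S x -> ideal_gen S (c *: x).
Proof. by move=> I; rewrite -[x]amul1l -amulZl; apply: IdealMl. Qed.

Definition quot_scale (c : k) (x : quot_alg) := quot_proj (c *: quot_lift x).
Definition quot_mul (x y : quot_alg) := quot_proj (quot_lift x ** quot_lift y).

Lemma quot_scaleE c x : quot_scale c (quot_proj x) = quot_proj (c *: x).
Proof.
by apply: quot_proj_eq; rewrite -scalerBr; apply/ideal_genZ/quot_lift_ideal.
Qed.

Lemma quot_mulE x y : quot_mul (quot_proj x) (quot_proj y) = quot_proj (x ** y).
Proof.
apply/eqP/quot_projP.
set x' := quot_lift _; set y' := quot_lift _.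
have -> : x' ** y' - x ** y = (x' - x) ** y' - x ** (y - y').
  by rewrite amulBl amulBr opprB addrA addrNK.
apply: IdealB; first exact/IdealMr/quot_lift_ideal.
apply: IdealMl; rewrite -opprB -[X in ideal_gen S X]add0r.
by apply: IdealB (Ideal0 _) (quot_lift_ideal _).
Qed.

Lemma quot_ind (P : quot_alg -> Prop) :
  (forall x, P (quot_proj x)) -> forall x, P x.
Proof. by move=> H x; rewrite -[x]quot_liftK. Qed.

Fact quot_scaleA a b x : quot_scale a (quot_scale b x) = quot_scale (a * b) x.
Proof. by elim/quot_ind: x => x; rewrite !quot_scaleE scalerA. Qed.
Fact quot_scale1 : left_id 1 quot_scale.
Proof. by elim/quot_ind => x; rewrite quot_scaleE scale1r. Qed.
Fact quot_scaleDr : right_distributive quot_scale +%R.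
Proof.
move=> c; elim/quot_ind => x; elim/quot_ind => y.
by rewrite -quot_projD !quot_scaleE scalerDr quot_projD.
Qed.
Fact quot_scaleDl x : {morph quot_scale^~ x : a b / a + b}.
Proof.
by elim/quot_ind: x => x a b; rewrite !quot_scaleE scalerDl quot_projD.
Qed.

HB.instance Definition _ := GRing.Zmodule_isLmodule.Build k quot_alg
  quot_scaleA quot_scale1 quot_scaleDr quot_scaleDl.

Lemma quot_projZ c x : quot_proj (c *: x) = c *: quot_proj x.
Proof. by rewrite -quot_scaleE. Qed.

Lemma quot_proj_linear : linear quot_proj.
Proof. by move=> c x y; rewrite quot_projD quot_projZ. Qed.

Fact quot_mulA : associative quot_mul.
Proof.
elim/quot_ind=> x; elim/quot_ind=> y; elim/quot_ind=> z.
by rewrite !quot_mulE amulA.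
Qed.
Fact quot_mul1l : left_id (quot_proj aone) quot_mul.
Proof. by elim/quot_ind=> x; rewrite quot_mulE amul1l. Qed.
Fact quot_mul1r : right_id (quot_proj aone) quot_mul.
Proof. by elim/quot_ind=> x; rewrite quot_mulE amul1r. Qed.
Fact quot_mul_linl y : linear (fun x => quot_mul x y).
Proof.
elim/quot_ind: y => y c; elim/quot_ind=> x; elim/quot_ind=> z.
by rewrite -quot_proj_linear !quot_mulE amul_linl quot_proj_linear.
Qed.
Fact quot_mul_linr x : linear (quot_mul x).
Proof.
elim/quot_ind: x => x c; elim/quot_ind=> y; elim/quot_ind=> z.
by rewrite -quot_proj_linear !quot_mulE amul_linr quot_proj_linear.
Qed.

HB.instance Definition _ := Lmodule_isAssocAlg.Build k quot_alg
  quot_mulA quot_mul1l quot_mul1r quot_mul_linl quot_mul_linr.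

Lemma quot_projM x y : quot_proj (x ** y) = quot_proj x ** quot_proj y.
Proof. exact/esym/quot_mulE. Qed.

End Quotient.

Section AlgAction.
Variables (k : fieldType) (gT : finGroupType).

Record alg_action (A : assocAlgType k) := AlgAction {
  alg_act :> gT -> A -> A;
  alg_act_lin : forall g, linear (alg_act g);
  alg_act_one : forall g, alg_act g aone = aone;
  alg_act_mul : forall g x y, alg_act g (x ** y) = alg_act g x ** alg_act g y;
  alg_act1 : forall x, alg_act 1%g x = x;
  alg_actM : forall g h x, alg_act (g * h)%g x = alg_act g (alg_act h x)
}.

Section QuotientAction.
Variables (A : assocAlgType k) (S : A -> Prop) (act : alg_action A).
Hypothesis actS : forall g s, S s -> ideal_gen S (act g s).

Definition quot_act (g : gT) (x : quot_alg S) : quot_alg S :=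
  quot_proj S (act g (quot_lift x)).

Lemma ideal_gen_act g x : ideal_gen S x -> ideal_gen S (act g x).
Proof.
elim=> [s /actS //||{}x y _ Ix _ Iy|a {}x _ Ix|a {}x _ Ix].
- by rewrite (lin0 (alg_act_lin act g)); apply: Ideal0.
- by rewrite (linB (alg_act_lin act g)); apply: IdealB.
- by rewrite alg_act_mul; apply: IdealMl.
- by rewrite alg_act_mul; apply: IdealMr.
Qed.

Lemma quot_actE g x : quot_act g (quot_proj S x) = quot_proj S (act g x).
Proof.
apply: quot_proj_eq; rewrite -(linB (alg_act_lin act g)).
exact/ideal_gen_act/quot_lift_ideal.
Qed.

Fact quot_act_lin g : linear (quot_act g).
Proof.
move=> c; elim/quot_ind=> x; elim/quot_ind=> y.
by rewrite -quot_proj_linear !quot_actE alg_act_lin quot_proj_linear.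
Qed.
Fact quot_act_one g : quot_act g aone = aone.
Proof. by rewrite quot_actE alg_act_one. Qed.
Fact quot_act_mul g x y : quot_act g (x ** y) = quot_act g x ** quot_act g y.
Proof.
elim/quot_ind: x => x; elim/quot_ind: y => y.
by rewrite -quot_projM !quot_actE alg_act_mul quot_projM.
Qed.
Fact quot_act1 x : quot_act 1%g x = x.
Proof. by elim/quot_ind: x => x; rewrite quot_actE alg_act1. Qed.
Fact quot_actM g h x : quot_act (g * h)%g x = quot_act g (quot_act h x).
Proof. by elim/quot_ind: x => x; rewrite !quot_actE alg_actM. Qed.

Definition quot_action : alg_action (quot_alg S) :=
  AlgAction quot_act_lin quot_act_one quot_act_mul quot_act1 quot_actM.

End QuotientAction.
End AlgAction.

Section ActionPullback.
Variables (k : fieldType) (gT rT : finGroupType) (A : assocAlgType k).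
Variables (act : alg_action gT A) (f : rT -> gT).
Hypotheses (f1 : f 1%g = 1%g) (fM : {morph f : g h / (g * h)%g}).

Fact comp_act1 x : act (f 1%g) x = x.
Proof. by rewrite f1 alg_act1. Qed.
Fact comp_actM g h x : act (f (g * h)%g) x = act (f g) (act (f h) x).
Proof. by rewrite fM alg_actM. Qed.

Definition comp_action : alg_action rT A :=
  AlgAction (fun g => alg_act_lin act (f g)) (fun g => alg_act_one act (f g))
    (fun g => alg_act_mul act (f g)) comp_act1 comp_actM.

End ActionPullback.

(* The skew group algebra: f : skew act stands for the sum over g of the      *)
(* elements g (f g) of kG (x) A.                                              *)

Definition skew (k : fieldType) (gT : finGroupType) (A : assocAlgType k)
  (act : alg_action gT A) : Type := {ffun gT -> A}.

Section Skew.
Variables (k : fieldType) (gT : finGroupType) (A : assocAlgType k).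
Variable act : alg_action gT A.

HB.instance Definition _ := GRing.Lmodule.copy (skew act) {ffun gT -> A}.

Definition skew_elt (g : gT) (a : A) : skew act :=
  [ffun x => if x == g then a else 0].

Definition skew_one : skew act := skew_elt 1%g aone.

(* (g a) (h b) = (g h) (h^-1(a) b) *)
Definition skew_mul (u v : skew act) : skew act :=
  [ffun x => \sum_(p : gT * gT | (p.1 * p.2)%g == x)
                act (p.2^-1)%g (u p.1) ** v p.2].

Lemma skew_mulE u v x :
  skew_mul u v x = \sum_(h : gT) act (h^-1)%g (u (x * h^-1)%g) ** v h.
Proof.
rewrite ffunE (reindex (fun h => ((x * h^-1)%g, h))) /=.
  by apply: eq_bigl => h; rewrite mulgKV eqxx.
exists snd => [h|[g h]] //; rewrite inE /= => /eqP <-.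
by rewrite mulgK.
Qed.

Fact skew_mul_linl v : linear (fun u => skew_mul u v).
Proof.
move=> c u w; apply/ffunP=> x; rewrite !ffunE scaler_sumr -big_split.
by apply: eq_bigr => p _; rewrite !ffunE alg_act_lin amul_linl.
Qed.
Fact skew_mul_linr u : linear (skew_mul u).
Proof.
move=> c v w; apply/ffunP=> x; rewrite !ffunE scaler_sumr -big_split.
by apply: eq_bigr => p _; rewrite !ffunE amul_linr.
Qed.
Fact skew_mul1l : left_id skew_one skew_mul.
Proof.
move=> u; apply/ffunP=> x; rewrite skew_mulE (bigD1 x) //= big1 => [|h hx].
  by rewrite ffunE mulgV eqxx alg_act_one amul1l addr0.
rewrite ffunE -eq_mulgV1 eq_sym (negPf hx).
by rewrite (lin0 (alg_act_lin act _)) amul0l.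
Qed.
Fact skew_mul1r : right_id skew_one skew_mul.
Proof.
move=> u; apply/ffunP=> x; rewrite skew_mulE (bigD1 1%g) //= big1 => [|h hx].
  by rewrite ffunE eqxx invg1 mulg1 alg_act1 amul1r addr0.
by rewrite ffunE (negPf hx) amul0r.
Qed.
Fact skew_mulA : associative skew_mul.
Proof.
move=> u v w; apply/ffunP=> x; rewrite !skew_mulE.
under eq_bigr do rewrite skew_mulE amul_sumr.
rewrite exchange_big /=.
under [RHS]eq_bigr => h _.
  rewrite skew_mulE (lin_sum (alg_act_lin act _)) amul_suml.
  rewrite (reindex_inj (mulIg h^-1)%g) /=.
  over.
rewrite [RHS]exchange_big /= [LHS]exchange_big /=.
apply: eq_bigr => g _; apply: eq_bigr => h _.
rewrite alg_act_mul amulA -alg_actM; congr (act _ (u _) ** _ ** _).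
  by rewrite invMg invgK mulgA mulVg mul1g.
by rewrite invMg invgK mulgA mulgKV.
Qed.

HB.instance Definition _ := Lmodule_isAssocAlg.Build k (skew act)
  skew_mulA skew_mul1l skew_mul1r skew_mul_linl skew_mul_linr.

Lemma skew_eltM g a h b :
  skew_elt g a ** skew_elt h b = skew_elt (g * h)%g (act h^-1%g a ** b).
Proof.
apply/ffunP=> x; rewrite [LHS]skew_mulE (bigD1 h) //= big1 => [|h' hx].
  rewrite !ffunE eqxx addr0 -(inj_eq (mulIg h)) mulgKV.
  by case: eqP => // _; rewrite (lin0 (alg_act_lin act _)) amul0l.
by rewrite !ffunE (negPf hx) amul0r.
Qed.

End Skew.

Record category := Category {
  ob :> Type;
  hom : ob -> ob -> Type;
  idc : forall x, hom x x;
  compc : forall x y z, hom y z -> hom x y -> hom x z;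
  compc1l : forall x y (f : hom x y), compc (idc y) f = f;
  compc1r : forall x y (f : hom x y), compc f (idc x) = f;
  compcA : forall w x y z (f : hom y z) (g : hom x y) (h : hom w x),
    compc f (compc g h) = compc (compc f g) h
}.

Record functor (C D : category) := Functor {
  fob :> C -> D;
  fhom : forall x y, hom x y -> hom (fob x) (fob y);
  fhom1 : forall x, fhom (idc x) = idc (fob x);
  fhomM : forall x y z (f : hom y z) (g : hom x y),
    fhom (compc f g) = compc (fhom f) (fhom g)
}.

Definition functor_id (C : category) : functor C C :=
  @Functor C C id (fun _ _ f => f) (fun _ => erefl) (fun _ _ _ _ _ => erefl).

Section FunctorComp.
Variables (C D E : category) (F : functor D E) (G : functor C D).
Fact functor_comp1 x : fhom F (fhom G (idc x)) = idc (F (G x)).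
Proof. by rewrite !fhom1. Qed.
Fact functor_compM x y z (f : hom y z) (g : hom x y) :
  fhom F (fhom G (compc f g)) = compc (fhom F (fhom G f)) (fhom F (fhom G g)).
Proof. by rewrite !fhomM. Qed.
Definition functor_comp : functor C E :=
  @Functor C E (fun x => F (G x)) (fun _ _ f => fhom F (fhom G f))
    functor_comp1 functor_compM.
End FunctorComp.

Record nat_iso (C D : category) (F G : functor C D) := NatIso {
  ni_hom : forall x, hom (F x) (G x);
  ni_inv : forall x, hom (G x) (F x);
  ni_homK : forall x, compc (ni_inv x) (ni_hom x) = idc (F x);
  ni_invK : forall x, compc (ni_hom x) (ni_inv x) = idc (G x);
  ni_nat : forall x y (f : hom x y),
    compc (ni_hom y) (fhom F f) = compc (fhom G f) (ni_hom x)
}.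

Definition is_equivalence (C D : category) (F : functor C D) : Prop :=
  exists G : functor D C,
    inhabited (nat_iso (functor_comp G F) (functor_id C)) /\
    inhabited (nat_iso (functor_comp F G) (functor_id D)).

Section Modules.
Variables (k : fieldType) (A : assocAlgType k).

Record fdmod := FdMod {
  fd_space :> vectType k;
  fd_act : A -> 'End(fd_space);
  fd_act_lin : linear fd_act;
  fd_act_one : fd_act aone = \1%VF;
  fd_act_mul : forall a b, fd_act (a ** b) = (fd_act a \o fd_act b)%VF
}.

Definition fdhom (V W : fdmod) :=
  {f : 'Hom(V, W) | forall a v, f (fd_act V a v) = fd_act W a (f v)}.

Lemma fdhom_inj V W (f g : fdhom V W) : sval f = sval g -> f = g.
Proof. by case: f g => [f fP] [g gP] /= fg; apply: eq_exist. Qed.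

Fact fdhom_id_subproof (V : fdmod) a (v : V) :
  \1%VF (fd_act V a v) = fd_act V a (\1%VF v).
Proof. by rewrite !id_lfunE. Qed.
Definition fdhom_id V : fdhom V V := exist _ \1%VF (@fdhom_id_subproof V).

Fact fdhom_comp_subproof U V W (f : fdhom V W) (g : fdhom U V) a (v : U) :
  (sval f \o sval g)%VF (fd_act U a v) = fd_act W a ((sval f \o sval g)%VF v).
Proof. by rewrite !comp_lfunE (svalP g) (svalP f). Qed.
Definition fdhom_comp U V W (f : fdhom V W) (g : fdhom U V) : fdhom U W :=
  exist _ (sval f \o sval g)%VF (@fdhom_comp_subproof U V W f g).

Fact fdhom_comp1l U V (f : fdhom U V) : fdhom_comp (fdhom_id V) f = f.
Proof. by apply: fdhom_inj; rewrite /= comp_lfun1l. Qed.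
Fact fdhom_comp1r U V (f : fdhom U V) : fdhom_comp f (fdhom_id U) = f.
Proof. by apply: fdhom_inj; rewrite /= comp_lfun1r. Qed.
Fact fdhom_compA T U V W (f : fdhom V W) (g : fdhom U V) (h : fdhom T U) :
  fdhom_comp f (fdhom_comp g h) = fdhom_comp (fdhom_comp f g) h.
Proof. by apply: fdhom_inj; rewrite /= comp_lfunA. Qed.

Definition fdmod_cat : category :=
  Category fdhom_comp1l fdhom_comp1r fdhom_compA.

End Modules.

Record quiver := Quiver {
  vertex :> finType;
  arrow : finType;
  tl : arrow -> vertex;
  hd : arrow -> vertex
}.

Section Path.
Variable Q : quiver.

(* The arrows of a path are listed in the order in which they are traversed. *)
Fixpoint composable (i : Q) (s : seq (arrow Q)) : bool :=
  if s is a :: s' then (tl a == i) && composable (hd a) s' else true.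

Definition qpath : Type := {p : Q * seq (arrow Q) | composable p.1 p.2}.
HB.instance Definition _ := SubChoice.on qpath.

Definition psrc (p : qpath) : Q := (val p).1.
Definition parrows (p : qpath) : seq (arrow Q) := (val p).2.
Definition ptgt (p : qpath) : Q := last (psrc p) (map (@hd Q) (parrows p)).

Lemma composable_cat i s t :
  composable i (s ++ t) =
    composable i s && composable (last i (map (@hd Q) s)) t.
Proof. by elim: s i => //= a s IH i; rewrite IH andbA. Qed.

Definition triv_path (i : Q) : qpath := exist _ (i, [::]) isT.

Fact arrow_path_subproof (a : arrow Q) : composable (tl a) [:: a].
Proof. by rewrite /= eqxx. Qed.
Definition arrow_path (a : arrow Q) : qpath :=
  exist _ (tl a, [:: a]) (arrow_path_subproof a).

(* The composite p q traverses q first; insub succeeds whenever it is reached *)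
(* (path_compP).                                                              *)
Definition path_comp (p q : qpath) : option qpath :=
  if ptgt q == psrc p then insub (psrc q, parrows q ++ parrows p) else None.

Variant path_comp_spec (p q : qpath) : option qpath -> Prop :=
| PathComp r of ptgt q = psrc p & psrc r = psrc q & ptgt r = ptgt p
    & parrows r = parrows q ++ parrows p : path_comp_spec p q (Some r)
| PathNoComp of ptgt q != psrc p : path_comp_spec p q None.

Lemma path_compP p q : path_comp_spec p q (path_comp p q).
Proof.
rewrite /path_comp; case: eqP => [e|/eqP]; last exact: PathNoComp.
have c : composable (psrc q) (parrows q ++ parrows p).
  by rewrite composable_cat (valP q) /= -/(ptgt q) e (valP p).
case: insubP => [r _ er|]; last by rewrite /= c.
have es : psrc r = psrc q by rewrite /psrc er.
have ea : parrows r = parrows q ++ parrows p by rewrite /parrows er.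
apply: PathComp => //.
by rewrite {1}/ptgt es ea map_cat last_cat -/(ptgt q) e.
Qed.

Lemma qpath_inj (p q : qpath) :
  psrc p = psrc q -> parrows p = parrows q -> p = q.
Proof.
move=> e1 e2; apply/val_inj; case: p q e1 e2 => [[i s] ?] [[j t] ?] /=.
by rewrite /psrc /parrows /= => -> ->.
Qed.

Lemma path_comp1l p i :
  path_comp (triv_path i) p = if i == ptgt p then Some p else None.
Proof.
case: path_compP => [r e1 e2 _ e3|]; rewrite eq_sym; last first.
  by move=> /negPf; rewrite /psrc /= => ->.
rewrite e1 /psrc /= eqxx; congr Some; apply: qpath_inj => //.
by rewrite e3 cats0.
Qed.

Lemma path_comp1r p i :
  path_comp p (triv_path i) = if i == psrc p then Some p else None.
Proof.
case: path_compP => [r e1 e2 _ e3|]; last first.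
  by rewrite /ptgt /psrc /= => /negPf ->.
rewrite -e1 /ptgt /psrc /= eqxx; congr Some; apply: qpath_inj => //.
by rewrite e2 -e1.
Qed.

Lemma path_compA p q r :
  obind (path_comp p) (path_comp q r) =
  obind (fun x => path_comp x r) (path_comp p q).
Proof.
case: (path_compP q r) => [qr e1 s1 t1 a1|n1] /=;
  case: (path_compP p q) => [pq e2 s2 t2 a2|n2] //=.
- case: path_compP => [x e3 s3 t3 a3|]; last by rewrite t1 e2 eqxx.
  case: path_compP => [y e4 s4 t4 a4|]; last by rewrite e1 s2 eqxx.
  congr Some; apply: qpath_inj; first by rewrite s3 s4.
  by rewrite a3 a4 a1 a2 catA.
- by case: path_compP => // x e3; rewrite -e3 t1 eqxx in n2.
- by case: path_compP => // x e3; rewrite e3 s2 eqxx in n1.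
Qed.

End Path.

HB.lock Definition lin_ext (k : fieldType) (K : choiceType) (L : lmodType k)
    (f : K -> L) (x : {malg k[K]}) : L :=
  \sum_(p <- msupp x) x@_p *: f p.

Section LinearExtension.
Variables (k : fieldType) (K : choiceType) (L : lmodType k).

Lemma lin_extEw (f : K -> L) (d : {fset K}) (x : {malg k[K]}) :
  (msupp x `<=` d)%fset ->
  lin_ext f x = \sum_(p <- d) x@_p *: f p.
Proof.
move=> le; rewrite lin_ext.unlock [LHS](big_fset_incl _ le) => //=
  p _ /mcoeff_outdom ->.
by rewrite scale0r.
Qed.

Lemma lin_ext_linear (f : K -> L) : linear (lin_ext f).
Proof.
move=> c x y; pose d := (msupp (c *: x + y) `|` (msupp x `|` msupp y))%fset.
rewrite !(@lin_extEw _ d) /d.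
- rewrite scaler_sumr -big_split; apply: eq_bigr => p _.
  by rewrite mcoeffD mcoeffZ scalerDl scalerA.
- exact: fsubset_trans (fsubsetUr _ _) (fsubsetUr _ _).
- exact: fsubset_trans (fsubsetUl _ _) (fsubsetUr _ _).
- exact: fsubsetUl.
Qed.

Lemma lin_ext_basis (f : K -> L) p : lin_ext f << p >> = f p.
Proof. by rewrite (lin_extEw _ msuppU_le) big_seq_fset1 mcoeffUU scale1r. Qed.

Lemma malg_lin_eq (f g : {malg k[K]} -> L) : linear f -> linear g ->
  (forall p, f << p >> = g << p >>) -> f =1 g.
Proof.
move=> lf lg e x; rewrite [x]monalgE (lin_sum lf) (lin_sum lg).
apply: eq_bigr => p _.
have -> : << x@_p *g p >> = x@_p *: << p >> :> {malg k[K]}.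
  by apply/malgP=> q; rewrite mcoeffZ !mcoeffU mulrnAr mulr1.
by rewrite (linZ lf) (linZ lg) e.
Qed.

End LinearExtension.

Definition path_alg (k : fieldType) (Q : quiver) : Type := {malg k[qpath Q]}.

HB.lock Definition path_elt (k : fieldType) (Q : quiver) (p : qpath Q) :
  path_alg k Q := << p >>.

Section PathAlgebra.
Variables (k : fieldType) (Q : quiver).
Local Notation kQ := (path_alg k Q).
Local Notation path_elt := (path_elt k).

HB.instance Definition _ := GRing.Lmodule.on kQ.

Definition pbasis_mul (p q : qpath Q) : kQ :=
  if path_comp p q is Some r then path_elt r else 0.

Definition path_mul (x y : kQ) : kQ :=
  lin_ext (fun p => lin_ext (pbasis_mul p) y) x.

Definition pidem (i : Q) : kQ := path_elt (triv_path i).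
Definition parrow (a : arrow Q) : kQ := path_elt (arrow_path a).

Definition path_one : kQ := \sum_(i : Q) pidem i.

Lemma path_mulE p q : path_mul (path_elt p) (path_elt q) = pbasis_mul p q.
Proof. by rewrite /path_mul path_elt.unlock !lin_ext_basis. Qed.

Fact path_mul_linl y : linear (fun x => path_mul x y).
Proof. exact: lin_ext_linear. Qed.

Fact path_mul_linr x : linear (path_mul x).
Proof.
move=> c y z; rewrite /path_mul !(lin_extEw _ (fsubset_refl (msupp x))).
rewrite scaler_sumr -big_split; apply: eq_bigr => p _ /=.
by rewrite lin_ext_linear scalerDr !scalerA [_ * c]mulrC.
Qed.

Lemma path_alg_eq (L : lmodType k) (f g : kQ -> L) : linear f -> linear g ->
  (forall p, f (path_elt p) = g (path_elt p)) -> f =1 g.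
Proof. by rewrite path_elt.unlock; apply: malg_lin_eq. Qed.

Fact path_mulA : associative path_mul.
Proof.
move=> x y z.
apply: (path_alg_eq (f := fun x => path_mul x (path_mul y z))
                    (g := fun x => path_mul (path_mul x y) z)).
- exact: path_mul_linl.
- by move=> c u v; rewrite !path_mul_linl.
move=> p.
apply: (path_alg_eq (f := fun y => path_mul (path_elt p) (path_mul y z))
                    (g := fun y => path_mul (path_mul (path_elt p) y) z)).
- by move=> c u v; rewrite path_mul_linl path_mul_linr.
- by move=> c u v; rewrite path_mul_linr path_mul_linl.
move=> q.
apply: (path_alg_eq (f := fun z => path_mul _ (path_mul _ z))
                    (g := fun z => path_mul _ z)).
- exact: (lin_comp (path_mul_linr (path_elt q)) (path_mul_linr (path_elt p))).
- exact: path_mul_linr.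
move=> r; rewrite (path_mulE q r) (path_mulE p q) /pbasis_mul.
have := path_compA p q r.
case: (path_comp q r) => [qr|]; case: (path_comp p q) => [pq|] /=.
- by rewrite (path_mulE p qr) (path_mulE pq r) /pbasis_mul => ->.
- by rewrite (path_mulE p qr) /pbasis_mul (lin0 (path_mul_linl _)) => ->.
- by rewrite (path_mulE pq r) /pbasis_mul (lin0 (path_mul_linr _)) => <-.
- by rewrite (lin0 (path_mul_linl _)) (lin0 (path_mul_linr _)).
Qed.

Fact path_mul1l : left_id path_one path_mul.
Proof.
apply: path_alg_eq => [|//|p]; first exact: path_mul_linr.
rewrite /path_one (lin_sum (path_mul_linl _)) (bigD1 (ptgt p)) //= big1.
  by rewrite (path_mulE (triv_path _)) /pbasis_mul path_comp1l eqxx addr0.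
move=> i ip.
by rewrite (path_mulE (triv_path i)) /pbasis_mul path_comp1l (negPf ip).
Qed.

Fact path_mul1r : right_id path_one path_mul.
Proof.
apply: path_alg_eq => [|//|p]; first exact: path_mul_linl.
rewrite /path_one (lin_sum (path_mul_linr _)) (bigD1 (psrc p)) //= big1.
  by rewrite (path_mulE p (triv_path _)) /pbasis_mul path_comp1r eqxx addr0.
move=> i ip.
by rewrite (path_mulE p (triv_path i)) /pbasis_mul path_comp1r (negPf ip).
Qed.

HB.instance Definition _ := Lmodule_isAssocAlg.Build k kQ
  path_mulA path_mul1l path_mul1r path_mul_linl path_mul_linr.

End PathAlgebra.

(* The automorphism group of a quiver, with g * h = g \o h.  (The product of  *)
(* {perm T} is composition in the opposite order.)                            *)

Definition is_quiver_aut (Q : quiver) (g : {perm Q} * {perm arrow Q}) : bool :=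
  [forall a, (tl (g.2 a) == g.1 (tl a)) && (hd (g.2 a) == g.1 (hd a))].

Definition quiver_aut (Q : quiver) : Type :=
  {g : {perm Q} * {perm arrow Q} | is_quiver_aut g}.

Section QuiverAut.
Variable Q : quiver.

HB.instance Definition _ := Finite.on (quiver_aut Q).

Definition vact (g : quiver_aut Q) (i : Q) : Q := (val g).1 i.
Definition aact (g : quiver_aut Q) (a : arrow Q) : arrow Q := (val g).2 a.

Lemma tl_aact g a : tl (aact g a) = vact g (tl a).
Proof. by have /forallP/(_ a)/andP[/eqP] := valP g. Qed.
Lemma hd_aact g a : hd (aact g a) = vact g (hd a).
Proof. by have /forallP/(_ a)/andP[_ /eqP] := valP g. Qed.

Lemma quiver_aut_eq g h : vact g =1 vact h -> aact g =1 aact h -> g = h.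
Proof.
move=> e1 e2; apply/val_inj; case: g h e1 e2 => [[g1 g2] ?] [[h1 h2] ?].
by rewrite /vact /aact /= => e1 e2; congr (_, _); apply/permP.
Qed.

Fact quiver_aut_one_subproof :
  is_quiver_aut (1%g, 1%g : {perm arrow Q}).
Proof. by apply/forallP=> a /=; rewrite !perm1 !eqxx. Qed.
Definition quiver_aut_one : quiver_aut Q :=
  exist (@is_quiver_aut Q) _ quiver_aut_one_subproof.

Fact quiver_aut_mul_subproof (g h : quiver_aut Q) :
  is_quiver_aut (((val h).1 * (val g).1)%g, ((val h).2 * (val g).2)%g).
Proof.
apply/forallP=> a /=; rewrite !permM -!/(aact _ _) -!/(vact _ _).
by rewrite !tl_aact !hd_aact !eqxx.
Qed.
Definition quiver_aut_mul g h : quiver_aut Q :=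
  exist (@is_quiver_aut Q) _ (quiver_aut_mul_subproof g h).

Fact quiver_aut_inv_subproof (g : quiver_aut Q) :
  is_quiver_aut (((val g).1)^-1%g, ((val g).2)^-1%g).
Proof.
apply/forallP=> a /=; have := tl_aact g ((val g).2^-1%g a).
have := hd_aact g ((val g).2^-1%g a); rewrite /aact /vact permKV => -> ->.
by rewrite !permK !eqxx.
Qed.
Definition quiver_aut_inv g : quiver_aut Q :=
  exist (@is_quiver_aut Q) _ (quiver_aut_inv_subproof g).

Fact quiver_aut_mulA : associative quiver_aut_mul.
Proof.
by move=> f g h; apply: quiver_aut_eq => x; rewrite /vact /aact /= !permM.
Qed.
Fact quiver_aut_mul1 : left_id quiver_aut_one quiver_aut_mul.
Proof.
by move=> f; apply: quiver_aut_eq => x; rewrite /vact /aact /= permM perm1.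
Qed.
Fact quiver_aut_mulV :
  left_inverse quiver_aut_one quiver_aut_inv quiver_aut_mul.
Proof.
move=> f; apply: quiver_aut_eq => x; rewrite /vact /aact /=;
by rewrite permM permK perm1.
Qed.

HB.instance Definition _ := Finite_isGroup.Build (quiver_aut Q)
  quiver_aut_mulA quiver_aut_mul1 quiver_aut_mulV.

Lemma vact1 i : vact 1%g i = i. Proof. exact: perm1. Qed.
Lemma aact1 a : aact 1%g a = a. Proof. exact: perm1. Qed.
Lemma vactM g h i : vact (g * h)%g i = vact g (vact h i).
Proof. exact: permM. Qed.
Lemma aactM g h a : aact (g * h)%g a = aact g (aact h a).
Proof. exact: permM. Qed.
Lemma vact_inj g : injective (vact g). Proof. exact: perm_inj. Qed.
Lemma aact_inj g : injective (aact g). Proof. exact: perm_inj. Qed.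

Lemma composable_map (g : quiver_aut Q) i s :
  composable (vact g i) (map (aact g) s) = composable i s.
Proof.
elim: s i => //= a s IH i.
by rewrite tl_aact hd_aact IH (inj_eq (@vact_inj g)).
Qed.

Fact path_act_subproof (g : quiver_aut Q) (p : qpath Q) :
  composable (vact g (psrc p)) (map (aact g) (parrows p)).
Proof. by rewrite composable_map (valP p). Qed.
Definition path_act (g : quiver_aut Q) (p : qpath Q) : qpath Q :=
  exist _ (vact g (psrc p), map (aact g) (parrows p)) (path_act_subproof g p).

Lemma ptgt_act g p : ptgt (path_act g p) = vact g (ptgt p).
Proof.
rewrite /ptgt -(last_map (vact g)) /psrc /parrows /= -!map_comp.
by congr last; apply: eq_map => a /=; rewrite hd_aact.
Qed.

Lemma path_comp_act g p q :
  path_comp (path_act g p) (path_act g q) = omap (path_act g) (path_comp p q).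
Proof.
case: (path_compP p q) => [r e1 e2 _ e3|n] /=.
  case: path_compP => [r' _ e4 _ e5|]; last first.
    by rewrite ptgt_act e1 /psrc /= eqxx.
  congr Some; apply: qpath_inj; first by rewrite e4 /psrc /= -!/(psrc _) e2.
  by rewrite e5 /parrows /= -!/(parrows _) -map_cat e3.
case: path_compP => // r; rewrite ptgt_act /psrc /= -!/(psrc _).
by move/vact_inj/eqP; rewrite (negPf n).
Qed.

Section PathAlgebraAction.
Variable k : fieldType.

Definition path_alg_act (g : quiver_aut Q) : path_alg k Q -> path_alg k Q :=
  lin_ext (fun p => path_elt k (path_act g p)).

Lemma path_alg_actE g p :
  path_alg_act g (path_elt k p) = path_elt k (path_act g p).
Proof. by rewrite /path_alg_act path_elt.unlock lin_ext_basis. Qed.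

Fact path_alg_act_lin g : linear (path_alg_act g).
Proof. exact: lin_ext_linear. Qed.

Lemma path_alg_act_idem g i : path_alg_act g (pidem k i) = pidem k (vact g i).
Proof. by rewrite path_alg_actE; congr path_elt; apply: qpath_inj. Qed.

Lemma path_alg_act_arrow g a :
  path_alg_act g (parrow k a) = parrow k (aact g a).
Proof.
rewrite path_alg_actE; congr path_elt; apply: qpath_inj => //.
by rewrite /psrc /= tl_aact.
Qed.

Fact path_alg_act_one g : path_alg_act g aone = aone.
Proof.
rewrite (lin_sum (path_alg_act_lin g)) /=.
under eq_bigr do rewrite path_alg_act_idem.
by rewrite [RHS](reindex_inj (@vact_inj g)).
Qed.

Fact path_alg_act_mul g x y :
  path_alg_act g (x ** y) = path_alg_act g x ** path_alg_act g y.
Proof.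
move: x; apply: path_alg_eq => [c u v|c u v|p].
- by rewrite amul_linl path_alg_act_lin.
- by rewrite path_alg_act_lin amul_linl.
move: y; apply: path_alg_eq => [c u v|c u v|q].
- by rewrite amul_linr path_alg_act_lin.
- by rewrite path_alg_act_lin amul_linr.
rewrite [_ ** _]path_mulE !path_alg_actE [in RHS]/amul /= path_mulE.
rewrite /pbasis_mul path_comp_act; case: path_comp => [r|] /=.
  exact: path_alg_actE.
exact: lin0 (path_alg_act_lin g).
Qed.

Fact path_alg_act1 x : path_alg_act 1%g x = x.
Proof.
move: x; apply: path_alg_eq => [|//|p]; first exact: path_alg_act_lin.
rewrite path_alg_actE; congr path_elt; apply: qpath_inj.
  by rewrite /psrc /= vact1.
by rewrite /parrows /= (eq_map aact1) map_id.
Qed.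

Fact path_alg_actM g h x :
  path_alg_act (g * h)%g x = path_alg_act g (path_alg_act h x).
Proof.
move: x; apply: path_alg_eq => [|c u v|p]; first exact: path_alg_act_lin.
  by rewrite !path_alg_act_lin.
rewrite !path_alg_actE; congr path_elt; apply: qpath_inj.
  by rewrite /psrc /= vactM.
by rewrite /parrows /= (eq_map (aactM g h)) map_comp.
Qed.

Definition path_alg_action : alg_action (quiver_aut Q) (path_alg k Q) :=
  AlgAction path_alg_act_lin path_alg_act_one path_alg_act_mul
    path_alg_act1 path_alg_actM.

End PathAlgebraAction.
End QuiverAut.

(* The double quiver: inl a is the arrow a, and inr a is the arrow a'.        *)

Definition double_quiver (Q : quiver) : quiver :=
  @Quiver Q (arrow Q + arrow Q)%type
    (fun b => match b with inl a => tl a | inr a => hd a end)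
    (fun b => match b with inl a => hd a | inr a => tl a end).

Section DoubleAction.
Variable Q : quiver.

Definition double_arrow_act (g : quiver_aut Q) (b : arrow (double_quiver Q)) :
    arrow (double_quiver Q) :=
  match b with inl a => inl (aact g a) | inr a => inr (aact g a) end.

Fact double_arrow_act_inj g : injective (double_arrow_act g).
Proof. by move=> [a|a] [b|b] //= [/aact_inj ->]. Qed.

Fact double_aut_subproof (g : quiver_aut Q) :
  @is_quiver_aut (double_quiver Q) ((val g).1, perm (@double_arrow_act_inj g)).
Proof.
apply/forallP=> -[a|a]; rewrite /= permE /= -!/(vact _ _) tl_aact hd_aact.
all: by rewrite !eqxx.
Qed.
Definition double_aut (g : quiver_aut Q) : quiver_aut (double_quiver Q) :=
  exist (@is_quiver_aut (double_quiver Q)) _ (double_aut_subproof g).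

Lemma vact_double g (i : Q) : vact (double_aut g) i = vact g i.
Proof. by []. Qed.
Lemma aact_double g b : aact (double_aut g) b = double_arrow_act g b.
Proof. exact: permE. Qed.

Fact double_aut1 : double_aut 1%g = 1%g.
Proof.
by apply: quiver_aut_eq => // -[a|a]; rewrite aact_double /= !aact1.
Qed.
Fact double_autM : {morph double_aut : g h / (g * h)%g}.
Proof.
move=> g h; apply: quiver_aut_eq => [i|[a|a]].
- by rewrite [RHS]vactM !vact_double vactM.
- by rewrite [RHS]aactM !aact_double /= aactM.
- by rewrite [RHS]aactM !aact_double /= aactM.
Qed.

End DoubleAction.

Section Preprojective.
Variables (k : fieldType) (Q : quiver).
Local Notation kQQ := (path_alg k (double_quiver Q)).

Definition darr (a : arrow Q) : kQQ :=
  parrow k (inl a : arrow (double_quiver Q)).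
Definition darr' (a : arrow Q) : kQQ :=
  parrow k (inr a : arrow (double_quiver Q)).

Definition preproj_elt (lam : {ffun Q -> k}) (i : Q) : kQQ :=
  \sum_(a : arrow Q | hd a == i) darr a ** darr' a
  - \sum_(a : arrow Q | tl a == i) darr' a ** darr a
  - lam i *: pidem k (i : double_quiver Q).

Definition preproj_rel (lam : {ffun Q -> k}) (x : kQQ) : Prop :=
  exists i : Q, x = preproj_elt lam i.

Definition preproj (lam : {ffun Q -> k}) : assocAlgType k :=
  quot_alg (preproj_rel lam).

Definition preproj_idem (lam : {ffun Q -> k}) (i : Q) : preproj lam :=
  quot_proj (preproj_rel lam) (pidem k (i : double_quiver Q)).

Definition gorbit (G : {set quiver_aut Q}) (i : Q) : {set Q} :=
  [set vact g i | g in G].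

Definition orbit_const (G : {set quiver_aut Q}) (lam : {ffun Q -> k}) : Prop :=
  forall i j : Q, j \in gorbit G i -> lam i = lam j.

End Preprojective.

Section PreprojectiveSkew.
Variables (k : fieldType) (Q : quiver) (G : {group quiver_aut Q}).
Variable lam : {ffun Q -> k}.

Definition path_subg_action :
    alg_action (subg_of G) (path_alg k (double_quiver Q)) :=
  comp_action
    (comp_action (path_alg_action (double_quiver Q) k)
       (@double_aut1 Q) (@double_autM Q))
    (f := @sgval _ G) erefl (fun _ _ => erefl).

Lemma path_subg_actionE (g : subg_of G) x :
  path_subg_action g x = path_alg_act (double_aut (sgval g)) x.
Proof. by []. Qed.

Hypothesis hlam : orbit_const G lam.

Fact preproj_rel_stable (g : subg_of G) x :
  preproj_rel lam x -> ideal_gen (preproj_rel lam) (path_subg_action g x).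
Proof.
move=> [i ->]; apply: Ideal_gen; exists (vact (sgval g) i).
rewrite path_subg_actionE; set h := sgval g.
have lin := @path_alg_act_lin (double_quiver Q) k (double_aut h).
rewrite /preproj_elt !(linB lin) (linZ lin) !(lin_sum lin).
rewrite path_alg_act_idem vact_double.
have -> : lam (vact h i) = lam i.
  by symmetry; apply: hlam; apply: imset_f; apply: valP g.
congr (_ - _ - _).
  rewrite [RHS](reindex_inj (@aact_inj _ h)) /=.
  apply: eq_big => [a|a _]; first by rewrite hd_aact (inj_eq (@vact_inj _ h)).
  by rewrite path_alg_act_mul !path_alg_act_arrow !aact_double.
rewrite [RHS](reindex_inj (@aact_inj _ h)) /=.
apply: eq_big => [a|a _]; first by rewrite tl_aact (inj_eq (@vact_inj _ h)).
by rewrite path_alg_act_mul !path_alg_act_arrow !aact_double.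
Qed.

Definition preproj_action : alg_action (subg_of G) (preproj lam) :=
  quot_action preproj_rel_stable.

Definition preproj_skew : assocAlgType k := skew preproj_action.

Definition preproj_skew_idem (i : Q) : preproj_skew :=
  skew_elt preproj_action 1%g (preproj_idem lam i).

Definition dimvec (V : fdmod preproj_skew) : {ffun Q -> int} :=
  [ffun i => (\dim (limg (fd_act V (preproj_skew_idem i))))%:Z].

End PreprojectiveSkew.

Section Reflections.
Variable Q : quiver.
Implicit Types (i j : Q) (al be : {ffun Q -> int}).

Definition loop_free i : Prop := forall a : arrow Q, ~ (tl a = i /\ hd a = i).

(* No arrow connects two distinct vertices of one orbit; a loop is not        *)
(* counted as connecting two vertices.                                        *)
Definition admissible (G : {set quiver_aut Q}) : Prop :=
  forall a : arrow Q, hd a \in gorbit G (tl a) -> hd a = tl a.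

Definition euler_form al be : int :=
  \sum_(i : Q) al i * be i - \sum_(a : arrow Q) al (tl a) * be (hd a).

Definition sym_form al be : int := euler_form al be + euler_form be al.

Definition eps i : {ffun Q -> int} := [ffun j => (j == i)%:R].

Definition vrefl i al : {ffun Q -> int} :=
  [ffun j => al j - sym_form al (eps i) * eps i j].

Definition lrefl (k : fieldType) i (lam : {ffun Q -> k}) : {ffun Q -> k} :=
  [ffun j => lam j - (sym_form (eps i) (eps j))%:~R * lam i].

(* The products over an orbit are compositions, taken along enum; for an      *)
(* admissible action the factors commute.                                     *)
Definition orbit_vrefl (G : {set quiver_aut Q}) i al : {ffun Q -> int} :=
  foldr vrefl al (enum (gorbit G i)).

Definition orbit_lrefl (k : fieldType) (G : {set quiver_aut Q}) i
    (lam : {ffun Q -> k}) : {ffun Q -> k} :=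
  foldr (@lrefl k) lam (enum (gorbit G i)).

Lemma euler_formE i j :
  euler_form (eps i) (eps j) =
    (i == j)%:R - \sum_(a : arrow Q) ((tl a == i) && (hd a == j))%:R.
Proof.
congr (_ - _); last by apply: eq_bigr => a _; rewrite !ffunE -natrM mulnb.
rewrite (bigD1 i) //= big1 => [|m mi]; rewrite !ffunE.
  by rewrite eqxx mul1r addr0.
by rewrite (negPf mi) mul0r.
Qed.

Lemma sym_form_act (g : quiver_aut Q) i j :
  sym_form (eps (vact g i)) (eps (vact g j)) = sym_form (eps i) (eps j).
Proof.
rewrite /sym_form !euler_formE !(inj_eq (@vact_inj _ g)).
by congr (_ - _ + (_ - _)); rewrite [LHS](reindex_inj (@aact_inj _ g));
  apply: eq_bigr => a _; rewrite tl_aact hd_aact !(inj_eq (@vact_inj _ g)).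
Qed.

Lemma gorbit_act (G : {group quiver_aut Q}) g i j : g \in G ->
  (vact g j \in gorbit G i) = (j \in gorbit G i).
Proof.
move=> Gg; apply/imsetP/imsetP=> [[h Gh e]|[h Gh ->]].
  exists (g^-1 * h)%g; first by rewrite groupM ?groupV.
  by apply: (@vact_inj _ g); rewrite -vactM mulKVg.
by exists (g * h)%g; rewrite ?groupM // vactM.
Qed.

Lemma gorbit_trans (G : {group quiver_aut Q}) i j m :
  j \in gorbit G i -> m \in gorbit G i -> m \in gorbit G j.
Proof.
move=> /imsetP[g Gg ->] /imsetP[h Gh ->]; apply/imsetP.
exists (h * g^-1)%g; first by rewrite groupM ?groupV.
by rewrite -vactM mulgKV.
Qed.

Lemma admissible_orth (G : {group quiver_aut Q}) i j m : admissible G ->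
  j \in gorbit G i -> m \in gorbit G i -> j != m ->
  sym_form (eps j) (eps m) = 0.
Proof.
move=> adm Oj Om jm; rewrite /sym_form !euler_formE [m == j]eq_sym (negPf jm).
rewrite !big1 ?subrr ?addr0 // => a _; case: andP => // -[/eqP ta /eqP ha].
  have /adm : hd a \in gorbit G (tl a).
    by rewrite ta ha; apply: gorbit_trans Om Oj.
  by rewrite ta ha => e; rewrite e eqxx in jm.
have /adm : hd a \in gorbit G (tl a).
  by rewrite ta ha; apply: gorbit_trans Oj Om.
by rewrite ta ha => e; rewrite e eqxx in jm.
Qed.

Lemma orbit_lreflE (k : fieldType) (G : {group quiver_aut Q}) i
    (lam : {ffun Q -> k}) m : admissible G ->
  orbit_lrefl G i lam m =
    lam m - \sum_(j in gorbit G i) (sym_form (eps j) (eps m))%:~R * lam j.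
Proof.
move=> adm; rewrite /orbit_lrefl -big_enum /=.
have sO : {subset enum (gorbit G i) <= gorbit G i}.
  by move=> j; rewrite mem_enum.
have := enum_uniq (gorbit G i); elim: (enum _) sO m => [|j s IH] sO m /=.
  by rewrite big_nil subr0.
move=> /andP[js us]; have sO' : {subset s <= gorbit G i}.
  by move=> x xs; apply: sO; rewrite inE xs orbT.
rewrite ffunE !IH // big_cons opprD addrA addrAC; congr (_ - _ - _ * _).
rewrite big_seq big1 ?subr0 // => x xs.
have xj : x != j by apply: contraNneq js => <-.
rewrite (admissible_orth adm (sO' x xs) (sO j (mem_head j s)) xj).
by rewrite mulr0z mul0r.
Qed.

Lemma orbit_lrefl_const (k : fieldType) (G : {group quiver_aut Q}) i
    (lam : {ffun Q -> k}) :
  admissible G -> orbit_const G lam -> orbit_const G (orbit_lrefl G i lam).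
Proof.
move=> adm hlam m _ /imsetP[g Gg ->].
have lamg n : lam n = lam (vact g n) by apply: hlam; apply: imset_f.
rewrite !orbit_lreflE // -lamg; congr (_ - _).
rewrite [RHS](reindex_inj (@vact_inj _ g)) /=.
apply: eq_big => [j|j _]; first by rewrite gorbit_act.
by rewrite sym_form_act -lamg.
Qed.

End Reflections.

(* Main.v *)
Require Import Defs.
From HB Require Import structures.
From mathcomp Require Import all_boot all_order all_algebra all_fingroup.

Set Implicit Arguments.
Unset Strict Implicit.
Unset Printing Implicit Defensive.

Import GRing.Theory.
Local Open Scope ring_scope.

(* All vertices of the orbit J of i are reflected at once, following          *)
(* Crawley-Boevey and Holland.  Put c = lambda_i, the common value of lambda  *)
(* on J.  For a module V and j in J, the relation at j says that mu pi = c,   *)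
(* where V_j --pi--> (+)_(hd b = j) V_(tl b) --mu--> V_j are assembled from   *)
(* the arrows of the double quiver (with signs in pi).  As c is invertible,   *)
(* pi mu / c is an idempotent; the reflected module replaces V_j by ker mu,   *)
(* and new arrows are the inclusion of ker mu (up to sign) and - c times the  *)
(* complementary projection.  Everything is natural, so G acts on the         *)
(* reflected module, and reflecting twice gives back V because                *)
(* pi : V_j -> ker (1 - pi mu / c) is an isomorphism.                         *)

(** * Modules over the skew group algebra as representations *)

(** A module over the skew group algebra amounts to a vector space with vertex idempotents,
    operators for the arrows of the double quiver and operators for [G], subject to the relations
    collected in [skew_rep]: [fdmod_of_rep] and [fdmod_skew_rep] pass between the two descriptions,
    and by [fdhom_of_generators] a linear map that commutes with the generators is a morphism. So it
    suffices to reflect representations in a way compatible with [G].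

    Let J be the orbit of i. Admissibility and loop-freeness leave no arrow between vertices of J
    ([orbit_darrow_free]), so the reflections at the vertices of J do not interfere and are made in
    one [G]-equivariant step. For j in J the map mu has the section pi / c, so the sum of the
    neighbouring spaces is the image of pi, a copy of V_j, plus ker mu. Reflection exchanges these
    summands. [refl_skew_rep] checks that the new weight is - c on J and grows by c, at a vertex
    outside J, for each arrow arriving from J; [orbit_reflectable] recognises this as the reflected
    weight.

    After reflection the map into ker mu is pi mu - c, whose kernel is the image of pi, so a second
    reflection restores V_j. The two isomorphisms are inverse by [unitK] and [counitK] and natural
    by [counit_natural], whence [reflection_equivalence]. Finally mu is onto, so rank-nullity
    computes dim ker mu ([dim_refl_on]), and [orbit_vreflE] identifies the result with the orbit
    reflection. *)

Section LinearToLfun.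
Variables (k : fieldType) (U W : vectType k).

Definition lfun_of (f : U -> W) (lf : linear f) : 'Hom(U, W) :=
  linfun (HB.pack_for {linear U -> W} f (GRing.isLinear.Build k U W *:%R f lf)).

Lemma lfun_ofE (f : U -> W) (lf : linear f) v : lfun_of lf v = f v.
Proof. by rewrite lfunE. Qed.

Lemma lfun_linear (f : 'Hom(U, W)) : linear f.
Proof. by move=> c x y; rewrite linearP. Qed.

Lemma lfunZ (f : 'Hom(U, W)) c v : f (c *: v) = c *: f v.
Proof. exact: linearZ. Qed.

Lemma lfunB (f : 'Hom(U, W)) u v : f (u - v) = f u - f v.
Proof. exact: linearB. Qed.

Lemma lfunD (f : 'Hom(U, W)) u v : f (u + v) = f u + f v.
Proof. exact: linearD. Qed.

End LinearToLfun.

(** * Arrows of the double quiver: duality, signs and the group action *)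

Section DoubleArrows.
Variable Q : quiver.
Local Notation D := (arrow (double_quiver Q)).

Implicit Types (k : fieldType) (b : D) (g : quiver_aut Q).

Definition dtl (b : D) : Q := tl b.
Definition dhd (b : D) : Q := hd b.
Definition dual (b : D) : D := match b with inl a => inr a | inr a => inl a end.
(** These signs merge the two sums of the preprojective relation into one sum over all arrows of the
    double quiver ending at a given vertex. *)
Definition dsign (k : fieldType) (b : D) : k := if b is inl _ then 1 else -1.

Lemma dualK : involutive dual. Proof. by case. Qed.
Lemma dtl_dual b : dtl (dual b) = dhd b. Proof. by case: b. Qed.
Lemma dhd_dual b : dhd (dual b) = dtl b. Proof. by case: b. Qed.
Lemma dsign_dual k b : dsign k (dual b) = - dsign k b.
Proof. by case: b => a /=; rewrite ?opprK. Qed.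
Lemma dsignM k b : dsign k b * dsign k b = 1.
Proof. by case: b => a /=; rewrite ?mulrNN mulr1. Qed.

Lemma dtl_act g b : dtl (double_arrow_act g b) = vact g (dtl b).
Proof. by case: b => a; rewrite /dtl /= ?tl_aact ?hd_aact. Qed.
Lemma dhd_act g b : dhd (double_arrow_act g b) = vact g (dhd b).
Proof. by case: b => a; rewrite /dhd /= ?tl_aact ?hd_aact. Qed.
Lemma dual_act g b : dual (double_arrow_act g b) = double_arrow_act g (dual b).
Proof. by case: b. Qed.
Lemma dsign_act k g b : dsign k (double_arrow_act g b) = dsign k b.
Proof. by case: b. Qed.
Lemma double_arrow_act1 b : double_arrow_act 1%g b = b.
Proof. by case: b => a; rewrite /= aact1. Qed.
Lemma double_arrow_actM g h b :
  double_arrow_act (g * h)%g b = double_arrow_act g (double_arrow_act h b).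
Proof. by case: b => a; rewrite /= aactM. Qed.

End DoubleArrows.

Section Representations.
Variables (k : fieldType) (Q : quiver) (G : {group quiver_aut Q}).
Local Notation D := (arrow (double_quiver Q)).

(** All operators live on one total space, and the vertex spaces are the images of the [E i]. This
    avoids families of types indexed by vertices, and lets a group element that permutes the
    vertices be a plain endomorphism. *)
Record skew_rep (lam : {ffun Q -> k}) (V : vectType k)
  (E : Q -> 'End(V)) (X : D -> 'End(V)) (T : subg_of G -> 'End(V)) : Prop := {
  rep_vM : forall i j v, E i (E j v) = if i == j then E i v else 0;
  rep_vsum : forall v, \sum_i E i v = v;
  rep_va : forall i b v, E i (X b v) = if i == dhd b then X b v else 0;
  rep_av : forall i b v, X b (E i v) = if i == dtl b then X b v else 0;
  rep_rel : forall i v,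
    \sum_(b | dhd b == i) dsign k b *: X b (X (dual b) v) = lam i *: E i v;
  rep_g1 : forall v, T 1%g v = v;
  rep_gM : forall g h v, T (g * h)%g v = T g (T h v);
  rep_gv : forall g i v, T g (E i v) = E (vact (sgval g) i) (T g v);
  rep_ga : forall g b v,
    T g (X b v) = X (double_arrow_act (sgval g) b) (T g v)
}.

Section Extension.
Variables (lam : {ffun Q -> k}) (hlam : orbit_const G lam).
Variables (V : vectType k) (E : Q -> 'End(V)) (X : D -> 'End(V)).
Variable T : subg_of G -> 'End(V).
Hypothesis R : skew_rep lam E X T.
Local Notation kQQ := (path_alg k (double_quiver Q)).
Local Notation rel := (preproj_rel lam).

Definition path_op (p : qpath (double_quiver Q)) : 'End(V) :=
  foldl (fun f b => (X b \o f)%VF) (E (psrc p)) (parrows p).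

Lemma path_opE p v :
  path_op p v = foldl (fun w b => X b w) (E (psrc p) v) (parrows p).
Proof.
rewrite /path_op; move: (parrows p) (E (psrc p)) => s.
elim: s => //= b s IH f; by rewrite IH comp_lfunE.
Qed.

Lemma foldl_op_tgt (i j : Q) s v : composable (Q := double_quiver Q) i s ->
  E j (foldl (fun w b => X b w) (E i v) s) =
    if j == last i (map (@dhd Q) s) then foldl (fun w b => X b w) (E i v) s
    else 0.
Proof.
elim/last_ind: s => [_|s b IH] /=.
  by rewrite (rep_vM R); case: eqP => // ->.
by move=> _; rewrite foldl_rcons map_rcons last_rcons (rep_va R).
Qed.

Lemma path_op_tgt p (j : Q) v :
  E j (path_op p v) = if j == ptgt p then path_op p v else 0.
Proof. by rewrite path_opE foldl_op_tgt // (valP p). Qed.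

Lemma foldl_lfun0 s : foldl (fun w b => X b w) (0 : V) s = 0.
Proof. by elim: s => //= b s IH; rewrite linear0. Qed.

Definition path_alg_op : kQQ -> 'End(V) := lin_ext path_op.

Lemma path_alg_op_linear : linear path_alg_op.
Proof. exact: lin_ext_linear. Qed.

Lemma path_alg_opE p : path_alg_op (path_elt k p) = path_op p.
Proof. by rewrite path_elt.unlock; apply: lin_ext_basis. Qed.

(** By bilinearity it is enough to compare two paths. If they do not compose, the product is 0, and
    so is the composite, because the idempotent at the source of p kills everything that arrives at
    another vertex ([path_op_tgt]). *)
Lemma path_alg_opM x y :
  path_alg_op (x ** y) = (path_alg_op x \o path_alg_op y)%VF.
Proof.
move: x; apply: path_alg_eq => [c u v|c u v|p].
- by rewrite amul_linl path_alg_op_linear.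
- by rewrite path_alg_op_linear comp_lfunDl comp_lfunZl.
move: y; apply: path_alg_eq => [c u v|c u v|q].
- by rewrite amul_linr path_alg_op_linear.
- by rewrite path_alg_op_linear comp_lfunDr comp_lfunZr.
rewrite [_ ** _]path_mulE !path_alg_opE /pbasis_mul.
apply/lfunP => v; rewrite comp_lfunE [RHS]path_opE path_op_tgt.
case: path_compP => [r e1 e2 e3 e4|n].
  by rewrite path_alg_opE [LHS]path_opE e2 e4 foldl_cat -path_opE -e1 eqxx.
rewrite (lin0 path_alg_op_linear) zero_lfunE eq_sym (negPf n).
by rewrite foldl_lfun0.
Qed.

Lemma path_alg_op_idem (i : Q) :
  path_alg_op (pidem k (i : double_quiver Q)) = E i.
Proof. by rewrite path_alg_opE. Qed.

Lemma path_alg_op_arrow (b : D) : path_alg_op (parrow k b) = X b.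
Proof.
rewrite path_alg_opE; apply/lfunP=> v; rewrite path_opE /=.
by rewrite (rep_av R) eqxx.
Qed.

Lemma path_alg_op1 : path_alg_op aone = \1%VF.
Proof.
apply/lfunP=> v; rewrite (lin_sum path_alg_op_linear) sum_lfunE id_lfunE.
rewrite -[RHS](rep_vsum R); apply: eq_bigr => i _.
by rewrite path_alg_op_idem.
Qed.

Lemma path_alg_op_act (g : subg_of G) x :
  (path_alg_op (path_subg_action k G g x) \o T g)%VF =
  (T g \o path_alg_op x)%VF.
Proof.
have al := alg_act_lin (path_subg_action k G) g.
move: x; apply: path_alg_eq => [c u v|c u v|p].
- by rewrite al path_alg_op_linear comp_lfunDl comp_lfunZl.
- by rewrite path_alg_op_linear comp_lfunDr comp_lfunZr.
rewrite path_subg_actionE path_alg_actE !path_alg_opE.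
apply/lfunP=> v; rewrite !comp_lfunE !path_opE.
rewrite -[psrc (path_act _ p)]/(vact (sgval g) (psrc p)).
rewrite -[parrows (path_act _ p)]/
  (map (aact (double_aut (sgval g))) (parrows p)).
rewrite -(rep_gv R); move: (E _ v) => {}v.
elim: (parrows p) v => //= b s IH v.
by rewrite aact_double -(rep_ga R) IH.
Qed.

Lemma path_alg_op_rel x : rel x -> path_alg_op x = 0.
Proof.
move=> [i ->]; apply/lfunP=> v; rewrite zero_lfunE /preproj_elt.
rewrite !(linB path_alg_op_linear) (linZ path_alg_op_linear).
rewrite !(lin_sum path_alg_op_linear) path_alg_op_idem.
rewrite !(add_lfunE, opp_lfunE, scale_lfunE, sum_lfunE).
rewrite -(rep_rel R) big_sumType /=.
under eq_bigr do rewrite path_alg_opM comp_lfunE !path_alg_op_arrow.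
under [X in _ - X - _]eq_bigr do
  rewrite path_alg_opM comp_lfunE !path_alg_op_arrow.
under [X in _ - (X + _)]eq_bigr do rewrite scale1r.
under [X in _ - (_ + X)]eq_bigr do rewrite scaleN1r.
by rewrite sumrN subrr.
Qed.

Lemma path_alg_op_ideal x : ideal_gen rel x -> path_alg_op x = 0.
Proof.
elim=> [s /path_alg_op_rel //||y z _ Iy _ Iz|a y _ Iy|a y _ Iy].
- exact: lin0 path_alg_op_linear.
- by rewrite (linB path_alg_op_linear) Iy Iz subrr.
- by rewrite path_alg_opM Iy comp_lfun0r.
- by rewrite path_alg_opM Iy comp_lfun0l.
Qed.

Definition preproj_op (x : preproj lam) : 'End(V) :=
  path_alg_op (quot_lift x).

Lemma preproj_opE x : preproj_op (quot_proj rel x) = path_alg_op x.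
Proof.
apply/eqP; rewrite -subr_eq0 -(linB path_alg_op_linear); apply/eqP.
exact/path_alg_op_ideal/quot_lift_ideal.
Qed.

Lemma preproj_op_linear : linear preproj_op.
Proof.
move=> c; elim/quot_ind=> x; elim/quot_ind=> y.
by rewrite -quot_proj_linear !preproj_opE path_alg_op_linear.
Qed.

Lemma preproj_opM x y :
  preproj_op (x ** y) = (preproj_op x \o preproj_op y)%VF.
Proof.
elim/quot_ind: x => x; elim/quot_ind: y => y.
by rewrite -quot_projM !preproj_opE path_alg_opM.
Qed.

Lemma preproj_op_act g x :
  (preproj_op (preproj_action hlam g x) \o T g)%VF = (T g \o preproj_op x)%VF.
Proof.
elim/quot_ind: x => x; rewrite [preproj_action _ _ _]quot_actE.
  by rewrite !preproj_opE path_alg_op_act.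
exact: preproj_rel_stable.
Qed.

Definition skew_op (u : preproj_skew hlam) : 'End(V) :=
  \sum_g (T g \o preproj_op (u g))%VF.

Lemma skew_op_linear : linear skew_op.
Proof.
move=> c u v; rewrite /skew_op scaler_sumr -big_split; apply: eq_bigr => g _.
by rewrite !ffunE preproj_op_linear comp_lfunDr comp_lfunZr.
Qed.

Lemma skew_op_elt g x :
  skew_op (skew_elt (preproj_action hlam) g x) = (T g \o preproj_op x)%VF.
Proof.
rewrite /skew_op (bigD1 g) //= big1 => [|h hg].
  by rewrite ffunE eqxx addr0.
by rewrite ffunE (negPf hg) (lin0 preproj_op_linear) comp_lfun0r.
Qed.

Lemma skew_op1 : skew_op aone = \1%VF.
Proof.
rewrite skew_op_elt [preproj_op _]preproj_opE path_alg_op1 comp_lfun1r.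
by apply/lfunP=> v; rewrite (rep_g1 R) id_lfunE.
Qed.

Lemma skew_sum (u : preproj_skew hlam) :
  u = \sum_g skew_elt (preproj_action hlam) g (u g).
Proof.
apply/ffunP=> x; rewrite sum_ffunE (bigD1 x) //= big1 => [|g gx].
  by rewrite ffunE eqxx addr0.
by rewrite ffunE eq_sym (negPf gx).
Qed.

(** The twist by the inverse of h in the skew product is absorbed by [preproj_op_act], which moves
    [T h] past the operator of an algebra element. *)
Lemma skew_op_eltM g x h y :
  skew_op (skew_elt (preproj_action hlam) g x ** skew_elt _ h y) =
  ((T g \o preproj_op x) \o (T h \o preproj_op y))%VF.
Proof.
rewrite skew_eltM skew_op_elt preproj_opM.
have -> : T (g * h)%g = (T g \o T h)%VF.
  by apply/lfunP=> w; rewrite comp_lfunE (rep_gM R).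
rewrite -!comp_lfunA; congr (_ \o _)%VF; rewrite !comp_lfunA.
by rewrite -preproj_op_act -alg_actM mulgV alg_act1.
Qed.

Lemma skew_opM u v : skew_op (u ** v) = (skew_op u \o skew_op v)%VF.
Proof.
apply/lfunP=> w; rewrite comp_lfunE.
transitivity (\sum_g \sum_h skew_op
    (skew_elt (preproj_action hlam) g (u g) ** skew_elt _ h (v h)) w).
  rewrite {1}[u]skew_sum amul_suml (lin_sum skew_op_linear) sum_lfunE.
  apply: eq_bigr => g _; rewrite {1}[v]skew_sum amul_sumr.
  by rewrite (lin_sum skew_op_linear) sum_lfunE.
rewrite /skew_op 2!sum_lfunE; apply: eq_bigr => g _.
rewrite linear_sum; apply: eq_bigr => h _.
by rewrite -/(skew_op _) skew_op_eltM comp_lfunE.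
Qed.

Definition fdmod_of_rep : fdmod (preproj_skew hlam) :=
  FdMod skew_op_linear skew_op1 skew_opM.

End Extension.

End Representations.

(** * Generators of the skew group algebra acting on a module *)

HB.lock Definition vop (k : fieldType) (Q : quiver) (G : {group quiver_aut Q})
    (lam : {ffun Q -> k}) (hlam : orbit_const G lam)
    (V : fdmod (preproj_skew hlam)) (i : Q) : 'End(V) :=
  fd_act V (preproj_skew_idem hlam i).

HB.lock Definition aop (k : fieldType) (Q : quiver) (G : {group quiver_aut Q})
    (lam : {ffun Q -> k}) (hlam : orbit_const G lam)
    (V : fdmod (preproj_skew hlam)) (b : arrow (double_quiver Q)) : 'End(V) :=
  fd_act V (skew_elt (preproj_action hlam) 1%g
              (quot_proj (preproj_rel lam) (parrow k b))).

HB.lock Definition gop (k : fieldType) (Q : quiver) (G : {group quiver_aut Q})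
    (lam : {ffun Q -> k}) (hlam : orbit_const G lam)
    (V : fdmod (preproj_skew hlam)) (g : subg_of G) : 'End(V) :=
  fd_act V (skew_elt (preproj_action hlam) g aone).

Section Generators.
Variables (k : fieldType) (Q : quiver) (G : {group quiver_aut Q}).
Local Notation D := (arrow (double_quiver Q)).
Variables (lam : {ffun Q -> k}) (hlam : orbit_const G lam).
Local Notation act := (preproj_action hlam).
Local Notation pr := (quot_proj (preproj_rel lam)).

Lemma skew_elt_linear g : linear (skew_elt act g).
Proof.
move=> c x y; apply/ffunP=> h; rewrite !ffunE.
by case: eqP => // _; rewrite scaler0 addr0.
Qed.

Lemma skew_elt1M x y :
  skew_elt act 1%g (x ** y) = skew_elt act 1%g x ** skew_elt act 1%g y.
Proof. by rewrite skew_eltM invg1 alg_act1 mulg1. Qed.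

Lemma skew_elt_split g x :
  skew_elt act g x = skew_elt act g aone ** skew_elt act 1%g x.
Proof. by rewrite skew_eltM alg_act_one amul1l mulg1. Qed.

Lemma skew_elt_comm g x :
  skew_elt act g aone ** skew_elt act 1%g x =
  skew_elt act 1%g (act g x) ** skew_elt act g aone.
Proof.
rewrite !skew_eltM -alg_actM mulVg alg_act1 alg_act_one.
by rewrite amul1l amul1r mul1g mulg1.
Qed.

Section Restriction.
Variable V : fdmod (preproj_skew hlam).

Definition base_op (x : path_alg k (double_quiver Q)) : 'End(V) :=
  fd_act V (skew_elt act 1%g (pr x)).

Lemma base_op_linear : linear base_op.
Proof.
by move=> c x y; rewrite /base_op quot_proj_linear skew_elt_linear fd_act_lin.
Qed.

Lemma base_opM x y : base_op (x ** y) = (base_op x \o base_op y)%VF.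
Proof. by rewrite /base_op quot_projM skew_elt1M fd_act_mul. Qed.

Lemma base_opMv x y v : base_op (x ** y) v = base_op x (base_op y v).
Proof. by rewrite base_opM comp_lfunE. Qed.

Lemma base_op_arrows (a b : D) v :
  base_op (parrow k a ** parrow k b) v = aop V a (aop V b v).
Proof. by rewrite aop.unlock base_opM comp_lfunE. Qed.

Lemma base_op1 : base_op aone = \1%VF.
Proof. exact: fd_act_one. Qed.

Lemma idem_idem (i j : double_quiver Q) :
  pidem k i ** pidem k j = if i == j then pidem k i else 0.
Proof.
rewrite [LHS]path_mulE /pbasis_mul path_comp1l.
by case: eqP => /= [->|]; rewrite ?eqxx.
Qed.

Lemma idem_arrow (i : double_quiver Q) (b : D) :
  pidem k i ** parrow k b = if i == dhd b then parrow k b else 0.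
Proof.
rewrite [LHS]path_mulE /pbasis_mul path_comp1l.
by rewrite -[ptgt _]/(dhd b); case: eqP.
Qed.

Lemma arrow_idem (i : double_quiver Q) (b : D) :
  parrow k b ** pidem k i = if i == dtl b then parrow k b else 0.
Proof.
rewrite [LHS]path_mulE /pbasis_mul path_comp1r.
by rewrite -[psrc _]/(dtl b); case: eqP.
Qed.

Lemma base_op_if (c : bool) x v :
  base_op (if c then x else 0) v = if c then base_op x v else 0.
Proof. by case: c => //; rewrite (lin0 base_op_linear) zero_lfunE. Qed.

Lemma gop_base g x v :
  gop V g (base_op x v) = base_op (path_subg_action k G g x) (gop V g v).
Proof.
rewrite gop.unlock.
transitivity (fd_act V (skew_elt act g aone ** skew_elt act 1%g (pr x)) v).
  by rewrite fd_act_mul comp_lfunE.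
rewrite skew_elt_comm fd_act_mul comp_lfunE.
have -> // : act g (pr x) = pr (path_subg_action k G g x).
exact: (quot_actE (preproj_rel_stable hlam)).
Qed.

Lemma fdmod_skew_rep : skew_rep lam (vop V) (aop V) (gop V).
Proof.
have rel_op := base_op_arrows; have gB := gop_base.
rewrite vop.unlock aop.unlock gop.unlock in rel_op gB *.
split=> [i j v|v|i b v|i b v|i v|v|g h v|g i v|g b v].
- by rewrite -base_op_if -idem_idem base_opMv.
- rewrite -[RHS]id_lfunE -base_op1 (lin_sum base_op_linear) sum_lfunE.
  by [].
- by rewrite -base_op_if -idem_arrow base_opMv.
- by rewrite -base_op_if -arrow_idem base_opMv.
- have: base_op (preproj_elt lam i) v = 0.
    have -> : base_op (preproj_elt lam i) = base_op 0; last first.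
      by rewrite (lin0 base_op_linear) zero_lfunE.
    congr (fd_act V (skew_elt _ _ _)); apply: quot_proj_eq; rewrite subr0.
    by apply: Ideal_gen; exists i.
  rewrite /preproj_elt !(linB base_op_linear) (linZ base_op_linear).
  rewrite !(lin_sum base_op_linear).
  rewrite !(add_lfunE, opp_lfunE, scale_lfunE, sum_lfunE).
  move/eqP; rewrite subr_eq0 => /eqP <-; rewrite big_sumType /=.
  rewrite -sumrN; congr (_ + _); apply: eq_bigr => a _.
    by rewrite scale1r; apply/esym/rel_op.
  by rewrite scaleN1r; congr (- _); apply/esym/rel_op.
- by rewrite (fd_act_one V) id_lfunE.
- rewrite -[RHS]comp_lfunE -fd_act_mul skew_eltM alg_act_one.
  by rewrite amul1l.
- by rewrite [LHS]gB path_subg_actionE path_alg_act_idem.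
- by rewrite [LHS]gB path_subg_actionE path_alg_act_arrow aact_double.
Qed.

End Restriction.

Section Builder.
Variables (V : vectType k) (E : Q -> 'End(V)) (X : D -> 'End(V)).
Variable T : subg_of G -> 'End(V).
Hypothesis R : skew_rep lam E X T.

Lemma vop_of_rep i v : vop (fdmod_of_rep hlam R) i v = E i v.
Proof.
rewrite vop.unlock [fd_act _ _]skew_op_elt ?comp_lfunE ?(rep_g1 R) //.
by rewrite [preproj_op _ _ _](preproj_opE R) path_alg_op_idem.
Qed.

Lemma aop_of_rep b v : aop (fdmod_of_rep hlam R) b v = X b v.
Proof.
rewrite aop.unlock [fd_act _ _]skew_op_elt ?comp_lfunE ?(rep_g1 R) //.
by rewrite (preproj_opE R) (path_alg_op_arrow R).
Qed.

Lemma gop_of_rep g v : gop (fdmod_of_rep hlam R) g v = T g v.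
Proof.
rewrite gop.unlock [fd_act _ _]skew_op_elt ?comp_lfunE //.
by rewrite [preproj_op _ _ _](preproj_opE R) (path_alg_op1 R) id_lfunE.
Qed.
End Builder.

(** The path algebra is spanned by paths, handled by induction on their length, and every skew
    element is a sum of products of a group element and an algebra element. *)
Lemma fdhom_of_generators (V W : fdmod (preproj_skew hlam)) (f : V -> W) :
    linear f ->
    (forall i v, f (vop V i v) = vop W i (f v)) ->
    (forall b v, f (aop V b v) = aop W b (f v)) ->
    (forall g v, f (gop V g v) = gop W g (f v)) ->
  forall a v, f (fd_act V a v) = fd_act W a (f v).
Proof.
move=> lf fv fa fg.
have fp x v : f (base_op V x v) = base_op W x (f v).
  rewrite -(lfun_ofE lf) -comp_lfunE.
  rewrite -[in RHS](lfun_ofE lf) -[RHS]comp_lfunE; congr (fun_of_lfun _ v).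
  move: x {v}; apply: path_alg_eq => [c x y|c x y|p].
  - by rewrite base_op_linear comp_lfunDr comp_lfunZr.
  - by rewrite base_op_linear comp_lfunDl comp_lfunZl.
  apply/lfunP=> v; rewrite !comp_lfunE !lfun_ofE.
  case: p => -[i s] /= sP.
  elim: s i sP v => [|b s IH] i sP v.
    have -> : path_elt k (exist _ (i, [::]) sP) = pidem k (i : double_quiver Q).
      by congr path_elt; apply: qpath_inj.
    by have := fv i v; rewrite vop.unlock.
  (* The arrow [b] is traversed first, hence is the right factor; the remaining path starts at its
     head. *)
  have /andP[/eqP bi sP'] := sP.
  pose p : qpath (double_quiver Q) := exist _ (hd b, s) sP'.
  have -> : path_elt k (exist _ (i, b :: s) sP) = path_elt k p ** parrow k b.
    rewrite [RHS]path_mulE /pbasis_mul.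
    case: path_compP => [r _ e1 _ e2|]; last by rewrite /ptgt /psrc /= eqxx.
    by congr path_elt; apply: qpath_inj; rewrite ?e1 ?e2 // /psrc /=.
  have bM U u : base_op U (path_elt k p ** parrow k b) u =
      base_op U (path_elt k p) (aop U b u).
    by rewrite aop.unlock base_opM comp_lfunE.
  by rewrite !bM IH fa.
move=> a v; rewrite [a]skew_sum; move: (a : {ffun _ -> _}) => {}a.
have sumE U u : fd_act U (\sum_g skew_elt act g (a g)) u =
    \sum_g gop U g (fd_act U (skew_elt act 1%g (a g)) u).
  rewrite (lin_sum (fd_act_lin U)) sum_lfunE; apply: eq_bigr => g _.
  by rewrite gop.unlock skew_elt_split fd_act_mul comp_lfunE.
rewrite !sumE (lin_sum lf); apply: eq_bigr => g _; rewrite fg.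
congr (gop W g _); elim/quot_ind: (a g) => x; exact: fp.
Qed.

End Generators.

(** * The reflected representation *)

Section SubspaceRestriction.
Variables (k : fieldType) (U : vectType k) (S : {vspace U}) (f : U -> U).
Hypotheses (lf : linear f) (fS : forall u, u \in S -> f u \in S).

Fact sub_fun_linear : linear (fun w : subvs_of S => vsproj S (f (vsval w))).
Proof. by move=> c x y; rewrite linearP lf linearP. Qed.

(** The projection [vsproj] makes the definition total; stability of [S] enters in [sub_lfunE],
    where the projection acts as the identity. *)
Definition sub_lfun : 'End(subvs_of S) := lfun_of sub_fun_linear.

Lemma sub_lfunE w : vsval (sub_lfun w) = f (vsval w).
Proof. by rewrite lfun_ofE vsprojK // fS // subvsP. Qed.

End SubspaceRestriction.

Section Reflection.
Variables (k : fieldType) (Q : quiver) (G : {group quiver_aut Q}).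
Local Notation D := (arrow (double_quiver Q)).
Local Notation sgn := (dsign k).

(* The sum in [refl_mu] is c times the number of arrows of the double quiver  *)
(* from J to m, which is - sum_(j in J) (eps_j, eps_m) c for m outside J.     *)
Record reflectable (J : {set Q}) (c : k) (lam mu : {ffun Q -> k}) : Prop := {
  refl_neq0 : c != 0;
  refl_stable : forall (g : subg_of G) i, (vact (sgval g) i \in J) = (i \in J);
  refl_free : forall b : D, dhd b \in J -> dtl b \notin J;
  refl_lam : forall j, j \in J -> lam j = c;
  refl_mu : forall m, mu m = if m \in J then - c
    else lam m + \sum_(b : D | (dhd b == m) && (dtl b \in J)) c
}.

(** Reflecting back is the same construction with c replaced by - c: the increments of the weight
    outside [J] cancel. *)
Lemma reflectable_sym J c lam mu :
  reflectable J c lam mu -> reflectable J (- c) mu lam.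
Proof.
case=> c0 st fr rl rm; split=> //.
- by rewrite oppr_eq0.
- by move=> j jJ; rewrite rm jJ.
move=> m; rewrite rm; case: (boolP (m \in J)) => [mJ|_].
  by rewrite opprK rl.
by rewrite -addrA -big_split big1 ?addr0 // => b _; rewrite /= subrr.
Qed.

Section Construction.
Variables (J : {set Q}) (c : k) (lam mu : {ffun Q -> k}).
Hypothesis H : reflectable J c lam mu.
Variables (V : vectType k) (E : Q -> 'End(V)) (X : D -> 'End(V)).
Variable T : subg_of G -> 'End(V).
Hypothesis R : skew_rep lam E X T.

Local Notation amb := (V * {ffun D -> V})%type.

Lemma rep_aa0 a b v : dtl a != dhd b -> X a (X b v) = 0.
Proof.
move=> ab; transitivity (X a (E (dtl a) (X b v))).
  by rewrite (rep_av R) eqxx.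
by rewrite (rep_va R) (negPf ab) linear0.
Qed.

(** After the arrow [b] only terms at the vertex [dhd b] survive, so the relation there may be
    summed over all arrows. *)
Lemma rep_rel_arrow b v :
  \sum_(b2 : D) sgn b2 *: X b2 (X (dual b2) (X b v)) = lam (dhd b) *: X b v.
Proof.
rewrite (bigID (fun b2 => dhd b2 == dhd b)) /= (rep_rel R) (rep_va R) eqxx.
rewrite big1 ?addr0 // => b2 nb; rewrite [X (dual b2) _]rep_aa0.
  by rewrite linear0 scaler0.
by rewrite dtl_dual.
Qed.

(* The reflected space consists of the pairs (v, f) with v in the sum of the  *)
(* E i V for i outside J, with f b in E (dtl b) V if b ends in J and f b = 0  *)
(* otherwise, such that the components f b are killed by the total map mu.    *)
Definition refl_con (x : amb) : {ffun Q -> V} * {ffun D -> V} * V :=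
  ([ffun j => if j \in J then E j x.1 else 0],
   [ffun b => x.2 b - (if dhd b \in J then E (dtl b) (x.2 b) else 0)],
   \sum_b X b (x.2 b)).

Fact refl_con_linear : linear refl_con.
Proof.
move=> a x y; congr (_, _, _).
- apply/ffunP=> j; rewrite !ffunE.
  by case: ifP; rewrite ?linearP ?scaler0 ?addr0.
- apply/ffunP=> b; rewrite !ffunE; case: ifP => _; rewrite ?subr0 //.
  by rewrite linearP scalerBr opprD addrACA.
rewrite /= scaler_sumr -big_split; apply: eq_bigr => b _.
by rewrite !ffunE linearP.
Qed.

Definition refl_space : {vspace amb} := lker (lfun_of refl_con_linear).

Lemma refl_spaceP (v : V) (f : {ffun D -> V}) :
  reflect [/\ forall j, j \in J -> E j v = 0,
              forall b, f b = if dhd b \in J then E (dtl b) (f b) else 0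
            & \sum_b X b (f b) = 0]
          ((v, f) \in refl_space).
Proof.
rewrite memv_ker lfun_ofE; apply: (iffP eqP) => [[e1 e2 e3]|[e1 e2 e3]].
  split=> // [j jJ|b].
    by have /ffunP/(_ j) := e1; rewrite !ffunE jJ.
  by have /ffunP/(_ b) := e2; rewrite !ffunE => /eqP; rewrite subr_eq0 => /eqP.
congr (_, _, _); last exact: e3.
  by apply/ffunP=> j; rewrite !ffunE; case: ifP => // /e1.
by apply/ffunP=> b; rewrite !ffunE -[X in _ - X]e2 subrr.
Qed.

(** The component of the family at [b] belongs to the vertex [dhd b] of the reflected module,
    although its value is a vector at [dtl b]. *)
Definition refl_v (i : Q) (x : amb) : amb :=
  (E i x.1, [ffun b => if dhd b == i then x.2 b else 0]).

(* On the reflected space: an arrow leaving J reads off, up to sign, the      *)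
(* component of its dual; an arrow b entering J sends v to the image of the   *)
(* vector with b-component v under pi mu - c; other arrows act by X b.        *)
Definition refl_a (b : D) (x : amb) : amb :=
  (if dhd b \in J then 0 else X b x.1 - sgn b *: x.2 (dual b),
   [ffun b2 => if dhd b \in J then
      sgn b2 *: X (dual b2) (X b x.1)
      - (if b2 == b then c *: E (dtl b) x.1 else 0) else 0]).

(** The usual action on families: the component at [b] is carried to the component at g b, hence the
    inverse on the index. *)
Definition refl_g (g : subg_of G) (x : amb) : amb :=
  (T g x.1, [ffun b => T g (x.2 (double_arrow_act (sgval (g^-1)%g) b))]).

Fact refl_v_linear i : linear (refl_v i).
Proof.
move=> a x y; congr (_, _); first exact: linearP.
by apply/ffunP=> b; rewrite !ffunE; case: ifP; rewrite ?scaler0 ?addr0.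
Qed.

Fact refl_a_linear b : linear (refl_a b).
Proof.
move=> a x y; rewrite /refl_a; case: ifP => bJ; congr (_, _).
- by rewrite /= scaler0 addr0.
- apply/ffunP=> b2; rewrite !ffunE /= !lfun_linear.
  case: ifP => _; rewrite ?subr0 !(scalerDr, scalerN) !scalerA.
    by rewrite [c * a]mulrC [_ * a]mulrC opprD addrACA.
  by rewrite mulrC.
- rewrite /= !ffunE lfun_linear !(scalerDr, scalerN) opprD !scalerA.
  by rewrite [_ * a]mulrC addrACA.
by apply/ffunP=> b2; rewrite !ffunE scaler0 addr0.
Qed.

Fact refl_g_linear g : linear (refl_g g).
Proof.
move=> a x y; congr (_, _); first exact: linearP.
by apply/ffunP=> b; rewrite !ffunE linearP.
Qed.

Lemma refl_v_stable i x : x \in refl_space -> refl_v i x \in refl_space.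
Proof.
case: x => v f /refl_spaceP[e1 e2 e3]; apply/refl_spaceP; split=> [j jJ|b|].
- by rewrite (rep_vM R); case: eqP => // _; rewrite e1.
- rewrite !ffunE /=; case: (dhd b == i); first exact: e2.
  by rewrite linear0 if_same.
transitivity (E i (\sum_b X b (f b))); last by rewrite e3 linear0.
rewrite linear_sum; apply: eq_bigr => b _; rewrite ffunE /= (rep_va R) eq_sym.
by case: eqP; rewrite ?linear0.
Qed.

Lemma refl_a_stable b x : x \in refl_space -> refl_a b x \in refl_space.
Proof.
case: x => v f /refl_spaceP[e1 e2 e3]; apply/refl_spaceP.
rewrite /=; case: ifP => bJ; split.
- by move=> j _; rewrite linear0.
- move=> b2; rewrite !ffunE; case: (boolP (dhd b2 \in J)) => b2J.
    rewrite lfunB lfunZ (rep_va R) dhd_dual eqxx; congr (_ - _).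
    case: eqP => [->|_]; last by rewrite linear0.
    by rewrite lfunZ (rep_vM R) eqxx.
  have ne : dhd b2 != dhd b by apply: contraNneq b2J => ->.
  rewrite rep_aa0 ?dtl_dual // scaler0 sub0r ifN ?oppr0 //.
  by apply: contraNneq ne => ->.
(* This is mu (pi mu - c) applied to a vector supported at [b]; it vanishes because mu pi = c. *)
- transitivity (\sum_b2 (sgn b2 *: X b2 (X (dual b2) (X b v)) -
      (if b2 == b then c *: X b2 (E (dtl b) v) else 0))).
    apply: eq_bigr => b2 _; rewrite ffunE lfunB lfunZ.
    by case: eqP => _; rewrite ?linear0 // lfunZ.
  rewrite sumrB -big_mkcond big_pred1_eq (rep_av R) eqxx.
  by rewrite rep_rel_arrow (refl_lam H bJ) subrr.
- move=> j jJ; rewrite lfunB lfunZ (rep_va R) ifN; last first.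
    by apply: contraFneq bJ => <-.
  rewrite e2 dhd_dual; case: ifP => _; last by rewrite linear0 scaler0 subr0.
  rewrite (rep_vM R) ifN ?scaler0 ?subr0 // dtl_dual.
  by apply: contraFneq bJ => <-.
- by move=> b2; rewrite !ffunE linear0 if_same.
by apply: big1 => b2 _; rewrite ffunE linear0.
Qed.

Lemma act_stable_arrow (g : subg_of G) b :
  (dhd (double_arrow_act (sgval g) b) \in J) = (dhd b \in J).
Proof. by rewrite dhd_act (refl_stable H). Qed.

Lemma double_arrow_actK (g : subg_of G) b :
  double_arrow_act (sgval g) (double_arrow_act (sgval (g^-1)%g) b) = b.
Proof. by rewrite -double_arrow_actM mulgV double_arrow_act1. Qed.

Lemma double_arrow_actKV (g : subg_of G) b :
  double_arrow_act (sgval (g^-1)%g) (double_arrow_act (sgval g) b) = b.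
Proof. by rewrite -double_arrow_actM mulVg double_arrow_act1. Qed.

Lemma vactKV (g : subg_of G) (i : Q) :
  vact (sgval g) (vact (sgval (g^-1)%g) i) = i.
Proof. by rewrite -vactM mulgV vact1. Qed.

Lemma refl_g_stable g x : x \in refl_space -> refl_g g x \in refl_space.
Proof.
case: x => v f /refl_spaceP[e1 e2 e3]; apply/refl_spaceP; split=> [j jJ|b|].
- rewrite -[j](vactKV g) -(rep_gv R) e1 ?linear0 //.
  by rewrite (refl_stable H).
- rewrite ffunE -[(v, f).2]/f e2 act_stable_arrow.
  case: ifP => _; last by rewrite linear0.
  by rewrite (rep_gv R) -dtl_act double_arrow_actK (rep_vM R) eqxx.
transitivity (T g (\sum_b X b (f b))); last by rewrite e3 linear0.
rewrite linear_sum (reindex_inj (can_inj (double_arrow_actKV g))) /=.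
by apply: eq_bigr => b _; rewrite ffunE (rep_ga R) double_arrow_actKV.
Qed.

Definition refl_vop i : 'End(subvs_of refl_space) :=
  sub_lfun refl_space (refl_v_linear i).
Definition refl_aop b : 'End(subvs_of refl_space) :=
  sub_lfun refl_space (refl_a_linear b).
Definition refl_gop g : 'End(subvs_of refl_space) :=
  sub_lfun refl_space (refl_g_linear g).

Lemma refl_vopE i w : vsval (refl_vop i w) = refl_v i (vsval w).
Proof. exact/sub_lfunE/refl_v_stable. Qed.
Lemma refl_aopE b w : vsval (refl_aop b w) = refl_a b (vsval w).
Proof. exact/sub_lfunE/refl_a_stable. Qed.
Lemma refl_gopE g w : vsval (refl_gop g w) = refl_g g (vsval w).
Proof. exact/sub_lfunE/refl_g_stable. Qed.

(** At a vertex of [J], leaving along [dual b] and coming back along [b] applies pi mu - c to the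
    component of f at [b], the signs cancelling. The sum over [b] is pi mu f - c f, and mu f = 0. *)
Lemma refl_rel_stable i v f : i \in J -> (v, f) \in refl_space ->
  \sum_(b | dhd b == i) sgn b *: refl_a b (refl_a (dual b) (v, f)) =
  - c *: refl_v i (v, f).
Proof.
move=> iJ /refl_spaceP[e1 e2 e3].
have eb b : dhd b == i -> refl_a (dual b) (v, f) = (sgn b *: f b, 0).
  move=> /eqP bi; have bJ : dtl b \notin J by rewrite (refl_free H) ?bi.
  rewrite /refl_a dhd_dual (negPf bJ) /=.
  congr (_, _).
  rewrite dualK dsign_dual scaleNr opprK.
  have := rep_av R i (dual b) v; rewrite dtl_dual bi eqxx => <-.
  by rewrite e1 // linear0 add0r.
under eq_bigr => b bi do rewrite eb //.
rewrite [LHS]surjective_pairing; congr (_, _).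
  rewrite (lin_sum (f := fst)) // big1 => [|b /eqP bi].
    by rewrite /= e1 // scaler0.
  by rewrite /= bi iJ scaler0.
apply/ffunP=> b2; rewrite (lin_sum (f := snd)) // sum_ffunE !ffunE /=.
transitivity (sgn b2 *: X (dual b2) (E i (\sum_b X b (f b))) -
    \sum_(b | dhd b == i) (if b2 == b then c *: f b else 0)).
  have -> : E i (\sum_b X b (f b)) = \sum_(b | dhd b == i) X b (f b).
    rewrite linear_sum [RHS]big_mkcond; apply: eq_bigr => b _.
    by rewrite /= (rep_va R) eq_sym.
  rewrite linear_sum scaler_sumr -sumrB; apply: eq_bigr => b /eqP bi.
  rewrite !ffunE bi iJ /= scalerBr !lfunZ.
  rewrite !scalerA mulrAC dsignM mul1r; congr (_ - _).
  case: eqP => _; last by rewrite scaler0.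
  rewrite [in RHS]e2 bi iJ !scalerA mulrCA dsignM mulr1 //.
rewrite e3 !linear0 sub0r -big_mkcondr /=.
case: (altP (dhd b2 =P i)) => [bi|bi].
  rewrite (big_pred1 b2) ?scaleNr // => b; rewrite /= (eq_sym b2).
  by apply: andb_idl => /eqP ->; rewrite bi.
rewrite big1 ?oppr0 ?scaler0 // => b /andP[b1 /eqP bb].
by rewrite bb b1 in bi.
Qed.

(** A round trip through a vertex of [J] yields the old term plus c, which comes from the - c in the
    new arrow entering [J]. Round trips avoiding [J] are unchanged, so the weight grows by c for
    each arrow from [J]. *)
Lemma refl_rel_free i v f : i \notin J -> (v, f) \in refl_space ->
  \sum_(b | dhd b == i) sgn b *: refl_a b (refl_a (dual b) (v, f)) =
  mu i *: refl_v i (v, f).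
Proof.
move=> iJ /refl_spaceP[e1 e2 e3].
have eb b : dhd b == i -> sgn b *: refl_a b (refl_a (dual b) (v, f)) =
    (sgn b *: X b (X (dual b) v) + (if dtl b \in J then c *: E i v else 0), 0).
  move=> /eqP bi; rewrite /refl_a bi (negPf iJ) /= dhd_dual; congr (_, _).
    case: ifP => bJ /=.
      rewrite linear0 sub0r ffunE eqxx dualK dtl_dual bi scalerN scalerA dsignM.
      by rewrite scale1r dsign_dual scaleNr opprB opprK addrC.
    rewrite !ffunE scaler0 subr0 addr0 dualK.
    by rewrite [f b]e2 bi (negPf iJ) scaler0 subr0.
  by apply/ffunP=> b2; rewrite !ffunE scaler0.
rewrite (eq_bigr _ eb) [LHS]surjective_pairing; congr (_, _); last first.
  transitivity (0 : {ffun D -> V}).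
    by rewrite (lin_sum (f := snd)) // big1.
  apply/ffunP=> b2; rewrite !ffunE /=; case: eqP => [bi|_].
    by rewrite [f b2]e2 bi (negPf iJ) scaler0.
  by rewrite scaler0.
rewrite (lin_sum (f := fst)) //= big_split /= (rep_rel R) (refl_mu H).
by rewrite (negPf iJ) scalerDl scaler_suml [in RHS]big_mkcondr.
Qed.

Lemma refl_vM i j x : refl_v i (refl_v j x) = if i == j then refl_v i x else 0.
Proof.
rewrite /refl_v /= (rep_vM R); case: (i =P j) => [->|/eqP ij]; congr (_, _).
  by apply/ffunP=> b; rewrite !ffunE; case: eqP.
apply/ffunP=> b; rewrite !ffunE; case: eqP => // ->.
by rewrite (negPf ij).
Qed.

Lemma refl_vsum x : \sum_i refl_v i x = x.
Proof.
rewrite [RHS]surjective_pairing [LHS]surjective_pairing; congr (_, _).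
  by rewrite (lin_sum (f := fst)) // (rep_vsum R).
apply/ffunP=> b; rewrite (lin_sum (f := snd)) // sum_ffunE /=.
under eq_bigr do rewrite ffunE.
by rewrite -big_mkcond (big_pred1 (dhd b)) // => i; rewrite /= eq_sym.
Qed.

Lemma refl_va i b x : x \in refl_space ->
  refl_v i (refl_a b x) = if i == dhd b then refl_a b x else 0.
Proof.
case: x => v f /refl_spaceP[_ e2 _]; rewrite /refl_v /refl_a /=.
case: ifP => bJ.
  transitivity ((0 : V, [ffun b2 => if i == dhd b then
      sgn b2 *: X (dual b2) (X b v) -
      (if b2 == b then c *: E (dtl b) v else 0) else 0] : {ffun D -> V})).
    congr (_, _); first exact: linear0.
    apply/ffunP=> b2; rewrite !ffunE; case: (b2 =P b) => [->|b2b].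
      by rewrite eq_sym.
    rewrite subr0; case: (dhd b2 =P i) => [<-|b2i]; case: eqP => //.
      move=> ne; rewrite rep_aa0 ?scaler0 // dtl_dual; exact/eqP.
    move=> ib; rewrite rep_aa0 ?scaler0 // dtl_dual -ib; exact/eqP.
  case: eqP => _ //; congr (_, _); apply/ffunP=> b2; by rewrite !ffunE.
rewrite lfunB lfunZ (rep_va R).
have -> : E i (f (dual b)) = if i == dhd b then f (dual b) else 0.
  rewrite e2; case: ifP => _; last by rewrite linear0 if_same.
  by rewrite (rep_vM R) dtl_dual; case: eqP => // ->.
case: eqP => _; congr (_, _); rewrite ?scaler0 ?subr0 //;
  by apply/ffunP=> b2; rewrite !ffunE if_same.
Qed.

Lemma refl_av i b x :
  refl_a b (refl_v i x) = if i == dtl b then refl_a b x else 0.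
Proof.
rewrite /refl_a /refl_v /= (rep_av R) (rep_vM R) !ffunE dhd_dual.
rewrite [dtl b == i]eq_sym; case: eqP => _; congr (_, _).
  by rewrite scaler0 subr0 if_same.
apply/ffunP=> b2; rewrite !ffunE !linear0 if_same subr0.
by rewrite if_same.
Qed.

Lemma refl_gv g i x :
  refl_g g (refl_v i x) = refl_v (vact (sgval g) i) (refl_g g x).
Proof.
congr (_, _); first exact: (rep_gv R).
apply/ffunP=> b; rewrite !ffunE [LHS](fun_if (T g)).
rewrite linear0 -[X in dhd X == vact _ _](double_arrow_actK g) [in RHS]dhd_act.
by rewrite (inj_eq (@vact_inj _ _)).
Qed.

Lemma refl_ga g b x :
  refl_g g (refl_a b x) = refl_a (double_arrow_act (sgval g) b) (refl_g g x).
Proof.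
rewrite /refl_a /refl_g act_stable_arrow; congr (_, _).
  case: ifP => _; first exact: linear0.
  rewrite lfunB lfunZ (rep_ga R) !ffunE dsign_act dual_act.
  by rewrite double_arrow_actKV.
apply/ffunP=> b2; rewrite !ffunE; case: ifP => _; last exact: linear0.
rewrite -[b2 in RHS](double_arrow_actK g).
move: (double_arrow_act (sgval (g^-1)%g) b2) => {}b2.
rewrite lfunB lfunZ !(rep_ga R) dsign_act dual_act; congr (_ - _).
rewrite (inj_eq (can_inj (double_arrow_actKV g))); case: eqP => _.
  by rewrite lfunZ (rep_gv R) dtl_act.
exact: linear0.
Qed.

Lemma refl_skew_rep : skew_rep mu refl_vop refl_aop refl_gop.
Proof.
have vif (b : bool) (w : subvs_of refl_space) :
    vsval (if b then w else 0) = if b then vsval w else 0 by case: b.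
split=> [i j w|w|i b w|i b w|i w|w|g h w|g i w|g b w]; apply: subvs_inj.
- by rewrite vif !refl_vopE refl_vM.
- rewrite linear_sum -[RHS]refl_vsum; apply: eq_bigr => i _.
  exact: refl_vopE.
- by rewrite vif refl_vopE !refl_aopE refl_va // subvsP.
- by rewrite vif !refl_aopE refl_vopE refl_av.
- rewrite linear_sum linearZ /= refl_vopE.
  under eq_bigr do rewrite !refl_aopE.
  have := subvsP w; case: (vsval w) => v f wS.
  case: (boolP (i \in J)) => iJ; last exact: refl_rel_free.
  by rewrite refl_rel_stable // (refl_mu H) iJ.
- rewrite refl_gopE; case: (vsval w) => v f; congr (_, _).
    exact: (rep_g1 R).
  by apply/ffunP=> b; rewrite !ffunE (rep_g1 R) invg1 double_arrow_act1.
- rewrite !refl_gopE; case: (vsval w) => v f; congr (_, _).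
    exact: (rep_gM R).
  apply/ffunP=> b; rewrite !ffunE (rep_gM R) invMg.
  by rewrite -double_arrow_actM.
- by rewrite refl_gopE !refl_vopE refl_gopE refl_gv.
by rewrite refl_gopE !refl_aopE refl_gopE refl_ga.
Qed.

End Construction.
End Reflection.

(** * The reflection functor *)

Section ReflectionFunctor.
Variables (k : fieldType) (Q : quiver) (G : {group quiver_aut Q}).
Local Notation D := (arrow (double_quiver Q)).
Local Notation sgn := (dsign k).

Section Functor.
Variables (J : {set Q}) (c : k) (lam mu : {ffun Q -> k}).
Hypotheses (hlam : orbit_const G lam) (hmu : orbit_const G mu).
Hypothesis H : reflectable G J c lam mu.

Local Notation fdm := (fdmod (preproj_skew hlam)).

Definition refl_mod (V : fdm) : fdmod (preproj_skew hmu) :=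
  fdmod_of_rep hmu (refl_skew_rep H (fdmod_skew_rep V)).

Definition rspace (V : fdm) := refl_space J (vop V) (aop V).

(** [rval] and [rproj] pass between the reflected module and explicit pairs, so that identities in
    the module can be checked on coordinates. *)
Definition rval (V : fdm) (w : refl_mod V) : V * {ffun D -> V} :=
  vsval (w : subvs_of (rspace V)).

Definition rproj (V : fdm) (x : V * {ffun D -> V}) : refl_mod V :=
  vsproj (rspace V) x.

Lemma rval_inj V : injective (@rval V). Proof. exact: subvs_inj. Qed.
Lemma rvalP V w : @rval V w \in rspace V. Proof. exact: subvsP. Qed.
Lemma rval_linear V : linear (@rval V).
Proof. by move=> a x y; rewrite /rval linearP. Qed.
Lemma rval0 V : rval (0 : refl_mod V) = 0.
Proof. exact: lin0 (@rval_linear V). Qed.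
Lemma rval_sum V (I : Type) (r : seq I) (P : pred I) (F : I -> refl_mod V) :
  rval (\sum_(i <- r | P i) F i) = \sum_(i <- r | P i) rval (F i).
Proof. by rewrite (lin_sum (@rval_linear V)). Qed.
Lemma rproj_linear V : linear (@rproj V).
Proof. by move=> a x y; rewrite /rproj linearP. Qed.
Lemma rprojK V x : x \in rspace V -> rval (rproj x) = x.
Proof. exact: vsprojK. Qed.

Lemma rval_vop V i w : rval (vop (refl_mod V) i w) = refl_v (vop V) i (rval w).
Proof. by rewrite vop_of_rep; apply: (refl_vopE (fdmod_skew_rep V)). Qed.
Lemma rval_aop V b w :
  rval (aop (refl_mod V) b w) = refl_a J c (vop V) (aop V) b (rval w).
Proof. by rewrite aop_of_rep; apply: (refl_aopE H (fdmod_skew_rep V)). Qed.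
Lemma rval_gop V g w : rval (gop (refl_mod V) g w) = refl_g (gop V) g (rval w).
Proof. by rewrite gop_of_rep; apply: (refl_gopE H (fdmod_skew_rep V)). Qed.

Section OnMorphisms.
Variables (V W : fdm) (f : fdhom V W).

Lemma fdhom_vop i v : sval f (vop V i v) = vop W i (sval f v).
Proof. by rewrite vop.unlock; apply: (svalP f). Qed.
Lemma fdhom_aop b v : sval f (aop V b v) = aop W b (sval f v).
Proof. by rewrite aop.unlock; apply: (svalP f). Qed.
Lemma fdhom_gop g v : sval f (gop V g v) = gop W g (sval f v).
Proof. by rewrite gop.unlock; apply: (svalP f). Qed.

(** The reflected space and operators are built from the operators of the module alone, so a
    morphism can be applied componentwise. *)
Definition pairmap (x : V * {ffun D -> V}) : W * {ffun D -> W} :=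
  (sval f x.1, [ffun b => sval f (x.2 b)]).

Lemma pairmap_linear : linear pairmap.
Proof.
move=> a x y; congr (_, _); first exact: linearP.
by apply/ffunP=> b; rewrite !ffunE linearP.
Qed.

Lemma pairmap_stable x : x \in rspace V -> pairmap x \in rspace W.
Proof.
case: x => v h /refl_spaceP[e1 e2 e3]; apply/refl_spaceP; split=> [j jJ|b|].
- by rewrite -fdhom_vop e1 ?linear0.
- rewrite ffunE -[(v, h).2]/h e2; case: ifP => _; last exact: linear0.
  by rewrite -fdhom_vop (rep_vM (fdmod_skew_rep V)) eqxx.
transitivity (sval f (\sum_b aop V b (h b))); last by rewrite e3 linear0.
by rewrite linear_sum; apply: eq_bigr => b _; rewrite ffunE /= -fdhom_aop.
Qed.

Definition refl_mod_fun (w : refl_mod V) : refl_mod W :=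
  rproj (pairmap (rval w)).

Lemma refl_mod_fun_linear : linear refl_mod_fun.
Proof.
move=> a x y.
by rewrite /refl_mod_fun rval_linear pairmap_linear rproj_linear.
Qed.

Lemma rval_refl_mod_fun w : rval (refl_mod_fun w) = pairmap (rval w).
Proof. exact/rprojK/pairmap_stable/rvalP. Qed.

Fact refl_mod_fun_hom a w :
  lfun_of refl_mod_fun_linear (fd_act (refl_mod V) a w) =
  fd_act (refl_mod W) a (lfun_of refl_mod_fun_linear w).
Proof.
rewrite !lfun_ofE; move: a w.
apply: fdhom_of_generators => [|i w|b w|g w]; first exact: refl_mod_fun_linear.
all: apply: rval_inj; rewrite rval_refl_mod_fun.
- rewrite !rval_vop rval_refl_mod_fun; case: (rval w) => v h.
  congr (_, _); first exact: fdhom_vop.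
  by apply/ffunP=> b; rewrite !ffunE (fun_if (sval f)) linear0.
- rewrite !rval_aop rval_refl_mod_fun; case: (rval w) => v h.
  rewrite /refl_a /pairmap /=; congr (_, _).
    rewrite (fun_if (sval f)) linear0 lfunB lfunZ fdhom_aop.
    by rewrite ffunE.
  apply/ffunP=> b2; rewrite !ffunE; case: ifP => _; last exact: linear0.
  rewrite lfunB lfunZ !fdhom_aop; congr (_ - _); rewrite (fun_if (sval f)).
  by rewrite lfunZ linear0 fdhom_vop.
rewrite !rval_gop rval_refl_mod_fun; case: (rval w) => v h.
congr (_, _); first exact: fdhom_gop.
by apply/ffunP=> b; rewrite !ffunE -fdhom_gop.
Qed.

Definition refl_mod_hom : fdhom (refl_mod V) (refl_mod W) :=
  exist _ (lfun_of refl_mod_fun_linear) refl_mod_fun_hom.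

Lemma rval_refl_mod_hom w : rval (sval refl_mod_hom w) = pairmap (rval w).
Proof. by rewrite lfun_ofE rval_refl_mod_fun. Qed.

End OnMorphisms.

Fact refl_mod_hom1 (V : fdm) :
  refl_mod_hom (fdhom_id V) = fdhom_id (refl_mod V).
Proof.
apply: fdhom_inj; apply/lfunP=> w; apply: rval_inj.
rewrite rval_refl_mod_hom id_lfunE [RHS]surjective_pairing.
congr (_, _); first exact: id_lfunE.
by apply/ffunP=> b; rewrite !ffunE id_lfunE.
Qed.

Fact refl_mod_homM (U V W : fdm) (f : fdhom V W) (g : fdhom U V) :
  refl_mod_hom (fdhom_comp f g) = fdhom_comp (refl_mod_hom f) (refl_mod_hom g).
Proof.
apply: fdhom_inj; apply/lfunP=> w; apply: rval_inj.
rewrite comp_lfunE !rval_refl_mod_hom.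
congr (_, _); first exact: comp_lfunE.
by apply/ffunP=> b; rewrite !ffunE comp_lfunE.
Qed.

Definition reflection : functor (fdmod_cat (preproj_skew hlam))
                                (fdmod_cat (preproj_skew hmu)) :=
  @Functor (fdmod_cat _) (fdmod_cat _) refl_mod refl_mod_hom refl_mod_hom1
    refl_mod_homM.

End Functor.
End ReflectionFunctor.

(** * Reflecting twice *)

Section DoubleReflection.
Variables (k : fieldType) (Q : quiver) (G : {group quiver_aut Q}).
Local Notation D := (arrow (double_quiver Q)).
Local Notation sgn := (dsign k).
Variables (J : {set Q}) (c c2 : k) (lam mu : {ffun Q -> k}).
Hypotheses (hlam : orbit_const G lam) (hmu : orbit_const G mu).
Hypotheses (H1 : reflectable G J c lam mu) (H2 : reflectable G J c2 mu lam).
Hypothesis c2E : c2 = - c.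

Section Object.
Variable V : fdmod (preproj_skew hlam).
Let RV := refl_mod hmu H1 V.
Let RRV := refl_mod hlam H2 RV.
Local Notation RP := (fdmod_skew_rep V).
Local Notation RP1 := (fdmod_skew_rep RV).

Definition off_proj (v : V) : V := \sum_(i | i \notin J) vop V i v.

Lemma off_proj_linear : linear off_proj.
Proof.
move=> a x y; rewrite /off_proj scaler_sumr -big_split; apply: eq_bigr => i _.
exact: lfun_linear.
Qed.

Lemma vop_off i v : vop V i (off_proj v) = if i \in J then 0 else vop V i v.
Proof.
rewrite linear_sum /=; under eq_bigr do rewrite (rep_vM RP).
rewrite -big_mkcondr /=; case: ifP => iJ.
  by rewrite big_pred0 // => j; case: eqP => [<-|_]; rewrite ?iJ ?andbF.
rewrite (big_pred1 i) // => j; rewrite /= [j == i]eq_sym.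
by apply: andb_idl => /eqP <-; rewrite iJ.
Qed.

Lemma off_projE v : v = off_proj v + \sum_(i in J) vop V i v.
Proof. by rewrite -[LHS](rep_vsum RP) (bigID (mem J)) addrC. Qed.

Lemma off_proj_id v : (forall j, j \in J -> vop V j v = 0) -> off_proj v = v.
Proof. by move=> e; rewrite [RHS]off_projE big1 ?addr0. Qed.

Lemma off_proj_vop i v :
  off_proj (vop V i v) = if i \in J then 0 else vop V i v.
Proof.
rewrite /off_proj; under eq_bigr => j _ do rewrite (rep_vM RP) eq_sym.
rewrite -big_mkcondr /=; case: ifP => iJ.
  by rewrite big_pred0 // => j; case: eqP => [<-|_]; rewrite ?iJ ?andbF.
rewrite (big_pred1 i) // => j; rewrite /= [j == i]eq_sym.
by apply: andb_idl => /eqP <-; rewrite iJ.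
Qed.

Lemma off_proj_aop b v :
  off_proj (aop V b v) = if dhd b \in J then 0 else aop V b v.
Proof.
have := rep_va RP (dhd b) b v; rewrite eqxx => <-.
exact: off_proj_vop.
Qed.

Lemma aop_vop b v : aop V b v = aop V b (vop V (dtl b) v).
Proof. by rewrite (rep_av RP) eqxx. Qed.

Lemma aop_off b v : aop V b (off_proj v) = if dtl b \in J then 0 else aop V b v.
Proof.
rewrite aop_vop vop_off; case: ifP => _; first exact: linear0.
by rewrite -aop_vop.
Qed.

Lemma gop_off g v : gop V g (off_proj v) = off_proj (gop V g v).
Proof.
rewrite linear_sum [RHS](reindex_inj (@vact_inj _ (sgval g))) /=.
apply: eq_big => [i|i _]; first by rewrite (refl_stable H1).
exact: (rep_gv RP).
Qed.

Lemma off_pair_in v : (off_proj v, 0) \in rspace J V.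
Proof.
apply/refl_spaceP; split=> [j jJ|b|].
- by rewrite vop_off jJ.
- by rewrite ffunE linear0 if_same.
by rewrite big1 // => b _; rewrite ffunE linear0.
Qed.

Definition incl (v : V) : RV := rproj hmu H1 (off_proj v, 0).

Lemma rval_incl v : rval (incl v) = (off_proj v, 0).
Proof. exact/rprojK/off_pair_in. Qed.

Lemma incl_linear : linear incl.
Proof.
move=> a x y; apply: rval_inj; rewrite rval_linear !rval_incl off_proj_linear.
by congr (_, _); apply/ffunP=> b; rewrite !ffunE scaler0 addr0.
Qed.

Lemma incl0 : incl 0 = 0. Proof. exact: lin0 incl_linear. Qed.

Lemma incl_off v : incl (off_proj v) = incl v.
Proof.
apply: rval_inj; rewrite !rval_incl off_proj_id // => j jJ.
by rewrite vop_off jJ.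
Qed.

Lemma incl_aop b v : dhd b \in J -> incl (aop V b v) = 0.
Proof. by move=> bJ; rewrite -incl_off off_proj_aop bJ incl0. Qed.

Lemma vop_incl i v : vop RV i (incl v) = incl (vop V i v).
Proof.
apply: rval_inj; rewrite rval_vop !rval_incl; congr (_, _).
  by rewrite /= vop_off off_proj_vop.
by apply/ffunP=> b; rewrite !ffunE if_same.
Qed.

Lemma vop_incl0 j v : j \in J -> vop RV j (incl v) = 0.
Proof.
by move=> jJ; rewrite vop_incl -incl_off off_proj_vop jJ incl0.
Qed.

Lemma gop_incl g v : gop RV g (incl v) = incl (gop V g v).
Proof.
apply: rval_inj; rewrite rval_gop !rval_incl; congr (_, _).
  exact: gop_off.
by apply/ffunP=> b; rewrite !ffunE linear0.
Qed.

Lemma aop_incl b v : dhd b \notin J ->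
  aop RV b (incl v) = if dtl b \in J then 0 else incl (aop V b v).
Proof.
move=> bJ; apply: rval_inj; rewrite rval_aop (fun_if (fun w : RV => rval w)).
rewrite rval0 !rval_incl.
rewrite /refl_a (negPf bJ) /= ffunE scaler0 subr0 aop_off off_proj_aop.
rewrite (negPf bJ).
by case: ifP => _.
Qed.

Lemma rval_aop_incl b v : dhd b \in J -> rval (aop RV b (incl v)) =
  (0, [ffun b2 => sgn b2 *: aop V (dual b2) (aop V b v)
        - (if b2 == b then c *: vop V (dtl b) v else 0)]).
Proof.
move=> bJ; rewrite rval_aop rval_incl /refl_a bJ /= aop_off vop_off.
by rewrite (negPf (refl_free H1 bJ)).
Qed.

(** Entering [J] by [b] produces a column of pi mu - c, and leaving by [dual b2] reads its entry at
    [b2], up to sign. *)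
Lemma aop_aop_incl b b2 v : dhd b \in J -> dhd b2 \in J ->
  aop RV (dual b2) (aop RV b (incl v)) =
  incl (aop V (dual b2) (aop V b v)
        - (if b2 == b then (sgn b * c) *: vop V (dtl b) v else 0)).
Proof.
move=> bJ b2J; apply: rval_inj; rewrite rval_aop rval_aop_incl // rval_incl.
rewrite /refl_a dhd_dual (negPf (refl_free H1 b2J)) /= linear0 sub0r dualK.
rewrite ffunE.
congr (_, _); rewrite dsign_dual scaleNr opprK scalerBr scalerA dsignM scale1r.
rewrite (linB off_proj_linear) off_proj_aop dhd_dual.
rewrite (negPf (refl_free H1 b2J)); congr (_ - _).
case: eqP => [->|_]; last by rewrite scaler0 (lin0 off_proj_linear).
rewrite scalerA (linZ off_proj_linear) off_proj_vop.
by rewrite (negPf (refl_free H1 bJ)).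
Qed.

(** The family part of [w] sits entirely at vertices of [J], so it vanishes here and [w] is
    determined by its first component. *)
Lemma inclK (w : RV) : (forall j, j \in J -> vop RV j w = 0) ->
  incl (rval w).1 = w.
Proof.
move=> e; apply: rval_inj; rewrite rval_incl.
have ej j : j \in J -> refl_v (vop V) j (rval w) = 0.
  by move=> /e ej; rewrite -rval_vop ej rval0.
have := rvalP w; case: (rval w) ej => v h ej /refl_spaceP[e1 e2 _].
congr (_, _); first exact: off_proj_id.
apply/ffunP=> b; rewrite ffunE; case: (boolP (dhd b \in J)) => bJ.
  by have [_ /ffunP/(_ b)] := ej _ bJ; rewrite !ffunE eqxx.
by rewrite e2 (negPf bJ).
Qed.

(* On V_j, j in J, this is pi, which maps onto the kernel of mu' =            *)
(* pi mu - c because mu pi = c.                                               *)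
Definition unit_pair (v : V) : RV * {ffun D -> RV} :=
  (incl v, [ffun b => if dhd b \in J then incl (sgn b *: aop V (dual b) v)
                      else 0]).

Lemma unit_pair_linear : linear unit_pair.
Proof.
move=> a x y; congr (_, _); first exact: incl_linear.
apply/ffunP=> b; rewrite !ffunE; case: ifP => _; last by rewrite scaler0 addr0.
by rewrite -incl_linear lfun_linear scalerDr !scalerA [a * _]mulrC.
Qed.

(** The identity mu pi = c at all vertices of [J] together, with the arrows grouped by their
    heads. *)
Lemma sum_stable v :
  \sum_(b | dhd b \in J) sgn b *: aop V b (aop V (dual b) v) =
  c *: \sum_(j in J) vop V j v.
Proof.
rewrite (partition_big (@dhd Q) (mem J)) //= scaler_sumr.
apply: eq_bigr => j jJ; rewrite -(refl_lam H1 jJ) -(rep_rel RP).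
by apply: eq_bigl => b; apply: andb_idl => /eqP ->.
Qed.

Lemma unit_pair_in v : unit_pair v \in rspace J RV.
Proof.
apply/refl_spaceP; split=> [j jJ|b|]; first exact: vop_incl0.
  rewrite ffunE; case: ifP => bJ //.
  by rewrite vop_incl lfunZ (rep_va RP) dhd_dual eqxx.
apply: rval_inj; rewrite rval0.
transitivity (\sum_(b | dhd b \in J)
    rval (aop RV b (incl (sgn b *: aop V (dual b) v)))).
  rewrite rval_sum [RHS]big_mkcond.
  apply: eq_bigr => b _; rewrite ffunE; case: ifP => // _.
  by rewrite linear0 rval0.
under eq_bigr => b bJ do rewrite rval_aop_incl //.
rewrite [LHS]surjective_pairing; congr (_, _).
  by rewrite (lin_sum (f := fst)) // big1.
apply/ffunP=> b2; rewrite (lin_sum (f := snd)) // sum_ffunE [RHS]ffunE.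
under eq_bigr do rewrite ffunE.
rewrite sumrB -big_mkcondr /=.
(* The first term is a component of pi mu pi v and the second one of c pi v; they agree by
   [sum_stable]. *)
transitivity (sgn b2 *: aop V (dual b2)
    (\sum_(b | dhd b \in J) sgn b *: aop V b (aop V (dual b) v)) -
    if dhd b2 \in J then c *: (sgn b2 *: aop V (dual b2) v) else 0).
  congr (_ - _).
    rewrite linear_sum scaler_sumr; apply: eq_bigr => b _ /=.
    by rewrite !lfunZ.
  case: ifP => b2J.
    rewrite (big_pred1 b2) => [|b].
      by rewrite lfunZ (rep_va RP) dhd_dual eqxx.
    by rewrite /= [b == _]eq_sym; apply: andb_idl => /eqP <-.
  by rewrite big_pred0 // => b; case: eqP => [<-|_]; rewrite ?b2J ?andbF.
rewrite sum_stable !lfunZ scalerA mulrC -scalerA.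
have -> : aop V (dual b2) (\sum_(j in J) vop V j v) =
    if dhd b2 \in J then aop V (dual b2) v else 0.
  rewrite {2}[v]off_projE linearD /= aop_off dtl_dual.
  case: (boolP (dhd b2 \in J)) => b2J; first by rewrite add0r.
  rewrite aop_vop linear_sum dtl_dual big1 ?linear0 // => j jJ /=.
  rewrite (rep_vM RP); case: eqP => // jb; by rewrite -jb (negPf b2J) in jJ.
by case: ifP => _; rewrite ?scaler0 subrr.
Qed.

Definition unit_fun (v : V) : RRV := rproj hlam H2 (unit_pair v).

Lemma rval_unit v : rval (unit_fun v) = unit_pair v.
Proof. exact/rprojK/unit_pair_in. Qed.

Lemma unit_linear : linear unit_fun.
Proof. by move=> a x y; rewrite /unit_fun unit_pair_linear rproj_linear. Qed.

Lemma unit_vop i v : unit_fun (vop V i v) = vop RRV i (unit_fun v).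
Proof.
apply: rval_inj; rewrite rval_vop !rval_unit; congr (_, _).
  by rewrite /= vop_incl.
apply/ffunP=> b; rewrite !ffunE (rep_av RP) dtl_dual eq_sym.
by do 2!case: ifP => _ //; rewrite scaler0 incl0.
Qed.

Lemma unit_gop g v : unit_fun (gop V g v) = gop RRV g (unit_fun v).
Proof.
apply: rval_inj; rewrite rval_gop !rval_unit; congr (_, _).
  by rewrite /= gop_incl.
apply/ffunP=> b; rewrite !ffunE.
rewrite -[b in LHS](double_arrow_actK g) dual_act dsign_act -(rep_ga RP).
rewrite (act_stable_arrow H1); case: ifP => _; last by rewrite linear0.
by rewrite gop_incl lfunZ.
Qed.

Lemma unit_aop b v : unit_fun (aop V b v) = aop RRV b (unit_fun v).
Proof.
apply: rval_inj; rewrite rval_aop !rval_unit /refl_a /unit_pair /=.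
case: (boolP (dhd b \in J)) => bJ; congr (_, _).
- exact: incl_aop.
- apply/ffunP=> b2; rewrite !ffunE; case: (boolP (dhd b2 \in J)) => b2J.
    rewrite aop_aop_incl // -(linZ incl_linear) scalerBr (linB incl_linear).
    rewrite -addrA -[LHS]addr0; congr (_ + _).
    (* At [b2 = b] the - c of the first reflection meets the - c2 = c of the second; they cancel,
       leaving pi applied to [aop V b v]. *)
    case: eqP => [->|_]; last first.
      by rewrite scaler0 incl0 !oppr0 addr0.
    rewrite scalerA mulrA dsignM mul1r vop_incl c2E (linZ incl_linear).
    by rewrite scaleNr opprK addNr.
  have ne : dhd b2 != dhd b by apply: contraNneq b2J => ->.
  rewrite (rep_aa0 RP1) ?dtl_dual // scaler0 sub0r ifN ?oppr0 //.
  by apply: contraNneq ne => ->.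
- rewrite aop_incl // ffunE dhd_dual dualK.
  case: ifP => _; last by rewrite scaler0 subr0.
  rewrite sub0r dsign_dual (linZ incl_linear) scalerA mulrN dsignM.
  by rewrite scaleN1r opprK.
apply/ffunP=> b2; rewrite !ffunE; case: ifP => // b2J.
have ne : dhd b2 != dhd b by apply: contraNneq bJ => <-.
by rewrite (rep_aa0 RP) ?dtl_dual // scaler0 incl0.
Qed.

(** The first summand restores the part outside [J]; on the vertices of [J] the second is mu / c,
    the inverse of pi on its image. *)
Definition counit_fun (z : RRV) : V :=
  (rval (rval z).1).1 + c^-1 *: \sum_b aop V b (rval ((rval z).2 b)).1.

Lemma unitK : cancel unit_fun counit_fun.
Proof.
move=> v; rewrite /counit_fun rval_unit /= rval_incl [RHS]off_projE.
congr (_ + _).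
rewrite -[RHS]scale1r -(mulVf (refl_neq0 H1)) -scalerA -sum_stable.
congr (_ *: _); rewrite [RHS]big_mkcond; apply: eq_bigr => b _.
rewrite ffunE; case: ifP => bJ.
  by rewrite rval_incl /= aop_off (negPf (refl_free H1 bJ)) lfunZ.
by rewrite rval0 linear0.
Qed.

(** The family h of an element of [RRV] is killed by pi mu - c, so pi (mu h / c) = h. *)
Lemma counitK : cancel counit_fun unit_fun.
Proof.
move=> z; apply: rval_inj; rewrite rval_unit /counit_fun.
have := rvalP z; case: (rval z) => w h /refl_spaceP[e1 e2 e3] /=.
have hK b : incl (rval (h b)).1 = h b.
  apply: inclK => j jJ; rewrite e2; case: ifP => bJ; last exact: linear0.
  rewrite (rep_vM RP1) ifN //.
  by apply: contraTneq jJ => ->; apply: refl_free H1 _ bJ.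
have wK : incl (rval w).1 = w by apply: inclK.
have hP b : off_proj (rval (h b)).1 = (rval (h b)).1.
  by rewrite -{2}[h b]hK rval_incl.
have wP : off_proj (rval w).1 = (rval w).1 by rewrite -{2}wK rval_incl.
have h0 b : dhd b \notin J -> h b = 0 by move=> bJ; rewrite e2 (negPf bJ).
congr (_, _).
  rewrite (linD incl_linear) (linZ incl_linear) (lin_sum incl_linear) wK.
  rewrite big1 ?scaler0 ?addr0 // => b _.
  case: (boolP (dhd b \in J)) => bJ; first exact: incl_aop.
  by rewrite h0 // rval0 linear0 incl0.
apply/ffunP=> b; rewrite ffunE; case: ifP => bJ; last by rewrite h0 ?bJ.
rewrite -[RHS]hK; congr (incl _).
(* The component at [b] of the condition pi mu h - c h = 0 defining the second reflection. *)
have := congr1 (fun x => (rval x).2 b) e3.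
rewrite rval0 [RHS]ffunE.
rewrite rval_sum (lin_sum (f := snd)) //.
rewrite sum_ffunE (eq_bigr (fun b2 =>
  sgn b *: aop V (dual b) (aop V b2 (rval (h b2)).1)
    - (if b == b2 then c *: (rval (h b2)).1 else 0))) => [|b2 _]; last first.
  rewrite -{1}[h b2]hK; case: (boolP (dhd b2 \in J)) => b2J.
    rewrite rval_aop_incl // ffunE; congr (_ - _); case: eqP => // _.
    have := congr1 (fun x => (rval x).1) (e2 b2); rewrite b2J rval_vop /= => <-.
    by [].
  rewrite hK h0 // linear0 rval0 !linear0.
  by rewrite [LHS]ffunE if_same subr0.
rewrite sumrB -big_mkcond (big_pred1 b (P := fun b2 => b == b2)); last first.
  by move=> b2; rewrite /= eq_sym.
move/eqP; rewrite subr_eq0 => /eqP e; rewrite lfunD.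
rewrite -wP aop_off dtl_dual bJ add0r lfunZ scalerA mulrC -scalerA.
rewrite linear_sum scaler_sumr e scalerA mulVf ?scale1r //.
exact: refl_neq0 H1.
Qed.

Fact unit_hom_subproof a v :
  lfun_of unit_linear (fd_act V a v) = fd_act RRV a (lfun_of unit_linear v).
Proof.
rewrite !lfun_ofE; move: a v; apply: fdhom_of_generators.
- exact: unit_linear.
- exact: unit_vop.
- exact: unit_aop.
exact: unit_gop.
Qed.

Lemma counit_linear : linear counit_fun.
Proof.
move=> a x y; apply: (can_inj unitK).
by rewrite unit_linear !counitK.
Qed.

Fact counit_hom_subproof a z :
  lfun_of counit_linear (fd_act RRV a z) = fd_act V a (lfun_of counit_linear z).
Proof.
rewrite !lfun_ofE; apply: (can_inj unitK); rewrite counitK.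
by have := unit_hom_subproof a (counit_fun z); rewrite !lfun_ofE counitK.
Qed.

Definition unit_hom : fdhom V RRV :=
  exist _ (lfun_of unit_linear) unit_hom_subproof.
Definition counit_hom : fdhom RRV V :=
  exist _ (lfun_of counit_linear) counit_hom_subproof.

Lemma unit_homK : fdhom_comp counit_hom unit_hom = fdhom_id V.
Proof.
apply: fdhom_inj; apply/lfunP=> v.
by rewrite comp_lfunE [LHS]lfun_ofE [sval unit_hom v]lfun_ofE unitK id_lfunE.
Qed.

Lemma counit_homK : fdhom_comp unit_hom counit_hom = fdhom_id RRV.
Proof.
apply: fdhom_inj; apply/lfunP=> v.
rewrite comp_lfunE [LHS]lfun_ofE [sval counit_hom v]lfun_ofE.
by rewrite counitK id_lfunE.
Qed.

End Object.

Lemma counit_natural (V W : fdmod (preproj_skew hlam)) (f : fdhom V W) :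
  fdhom_comp (counit_hom W)
    (refl_mod_hom hlam H2 (refl_mod_hom hmu H1 f)) =
  fdhom_comp f (counit_hom V).
Proof.
apply: fdhom_inj; apply/lfunP=> z; rewrite !comp_lfunE !lfun_ofE /counit_fun.
rewrite rval_refl_mod_fun /pairmap /= !lfun_ofE !rval_refl_mod_fun linearD /=.
rewrite lfunZ; congr (_ + _ *: _); rewrite [RHS]linear_sum.
apply: eq_bigr => b _; rewrite ffunE lfun_ofE rval_refl_mod_fun /=.
by rewrite fdhom_aop.
Qed.

Definition double_reflection :
  nat_iso (functor_comp (reflection hmu hlam H2) (reflection hlam hmu H1))
          (functor_id (fdmod_cat (preproj_skew hlam))) :=
  @NatIso _ _ (functor_comp (reflection hmu hlam H2) (reflection hlam hmu H1))
    (functor_id (fdmod_cat (preproj_skew hlam)))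
    counit_hom unit_hom counit_homK unit_homK counit_natural.

End DoubleReflection.

(** Both natural isomorphisms are instances of [double_reflection], with the two reflections in
    either order. Its separate parameter c2 with c2 = - c serves the second order, where c is only
    provably equal to - (- c). *)
Lemma reflection_equivalence (k : fieldType) (Q : quiver)
    (G : {group quiver_aut Q}) (J : {set Q}) (c : k) (lam mu : {ffun Q -> k})
    (hlam : orbit_const G lam) (hmu : orbit_const G mu)
    (H : reflectable G J c lam mu) :
  is_equivalence (reflection hlam hmu H).
Proof.
exists (reflection hmu hlam (reflectable_sym H)); split; constructor.
  exact: double_reflection.
by apply: double_reflection; rewrite opprK.
Qed.

(** * Dimension vectors *)

Section Dimensions.
Variable k : fieldType.

(** The left inverse certifies that the linear map is injective on [U]. Used in both directions,
    this yields equalities of dimensions. *)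
Lemma dimv_leq_retract (A B : vectType k) (U : {vspace A}) (W : {vspace B})
    (phi : A -> B) (psi : B -> A) : linear phi ->
  {in U, forall u, phi u \in W} -> {in U, cancel phi psi} ->
  (\dim U <= \dim W)%N.
Proof.
move=> lphi phiW phiK; rewrite -(@limg_dim_eq _ _ _ (lfun_of lphi)).
  apply/dimvS/subvP=> _ /memv_imgP[u uU ->].
  by rewrite lfun_ofE phiW.
apply/eqP; rewrite -subv0; apply/subvP=> u /memv_capP[uU].
rewrite memv_ker lfun_ofE memv0 => /eqP u0.
by rewrite -(phiK u uU) u0 -(lin0 lphi) phiK ?mem0v.
Qed.

Section FfunSpace.
Variables (I : finType) (V : vectType k) (P : pred I) (U : I -> {vspace V}).

Definition ffun_delta (b : I) (v : V) : {ffun I -> V} :=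
  [ffun a => if a == b then v else 0].

Lemma ffun_delta_linear b : linear (ffun_delta b).
Proof.
move=> c x y; apply/ffunP=> a; rewrite !ffunE.
by case: ifP => _; rewrite ?scaler0 ?addr0.
Qed.

Lemma ffun_delta_sum (f : {ffun I -> V}) : f = \sum_b ffun_delta b (f b).
Proof.
apply/ffunP=> a; rewrite sum_ffunE (bigD1 a) //= big1 => [|b ba].
  by rewrite ffunE eqxx addr0.
by rewrite ffunE eq_sym (negPf ba).
Qed.

(** Such a [Y] is the direct sum of the copies of the [U b] embedded by the injective maps
    [ffun_delta b]. *)
Lemma dim_ffun_space (Y : {vspace {ffun I -> V}}) :
  (forall f : {ffun I -> V},
     reflect (forall b, if P b then f b \in U b else f b == 0) (f \in Y)) ->
  \dim Y = (\sum_(b | P b) \dim (U b))%N.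
Proof.
move=> YP; pose D b := lfun_of (ffun_delta_linear b).
have DE b v a : D b v a = if a == b then v else 0 by rewrite lfun_ofE ffunE.
have -> : Y = (\sum_(b | P b) D b @: U b)%VS.
  apply/vspaceP=> f; apply/YP/memv_sumP => [fY|[g gU ->] a].
    exists (fun b => D b (f b)) => [b Pb|].
      by apply: memv_img; have := fY b; rewrite Pb.
    rewrite {1}[f]ffun_delta_sum [RHS]big_mkcond; apply: eq_bigr => b _.
    have := fY b; rewrite lfun_ofE; case: ifP => // _ /eqP ->.
    by rewrite (lin0 (ffun_delta_linear b)).
  rewrite sum_ffunE; case: ifP => Pa.
    rewrite (bigD1 a) //= big1 => [|b /andP[Pb ba]].
      by have /memv_imgP[v vU ->] := gU a Pa; rewrite addr0 DE eqxx.
    by have /memv_imgP[v _ ->] := gU b Pb; rewrite DE eq_sym (negPf ba).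
  apply/eqP/big1 => b Pb; have /memv_imgP[v _ ->] := gU b Pb.
  by rewrite DE; case: eqP => // ab; rewrite ab Pb in Pa.
rewrite (directvP _) /=; last first.
  apply/directv_sum_independent => us usU us0 b Pb.
  have /memv_imgP[v _ ev] := usU b Pb.
  have := congr1 (fun f : {ffun I -> V} => f b) us0.
  rewrite sum_ffunE ffunE (bigD1 b) //= big1 => [|a /andP[Pa ab]].
    by rewrite addr0 ev DE eqxx => ->; rewrite linear0.
  by have /memv_imgP[u _ ->] := usU a Pa; rewrite DE eq_sym (negPf ab).
apply: eq_bigr => b Pb; apply: limg_dim_eq; apply/eqP; rewrite -subv0.
apply/subvP=> u /memv_capP[_]; rewrite memv_ker memv0 => /eqP u0.
by have := DE b u b; rewrite u0 ffunE eqxx => <-.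
Qed.

End FfunSpace.

Variables (Q : quiver) (G : {group quiver_aut Q}).
Local Notation D := (arrow (double_quiver Q)).
Local Notation sgn := (dsign k).
Variables (J : {set Q}) (c : k) (lam mu : {ffun Q -> k}).
Hypotheses (hlam : orbit_const G lam) (hmu : orbit_const G mu).
Hypothesis H : reflectable G J c lam mu.
Variable V : fdmod (preproj_skew hlam).
Let RV := refl_mod hmu H V.
Local Notation RP := (fdmod_skew_rep V).
Local Notation RP1 := (fdmod_skew_rep RV).

Lemma limg_vopP i v : reflect (vop V i v = v) (v \in limg (vop V i)).
Proof.
apply: (iffP idP) => [/memv_imgP[u _ ->]|<-].
  by rewrite (rep_vM RP) eqxx.
by rewrite memv_img ?memvf.
Qed.

Lemma dim_refl_off i : i \notin J ->
  \dim (limg (vop RV i)) = \dim (limg (vop V i)).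
Proof.
move=> iJ; apply/eqP; rewrite eqn_leq; apply/andP; split.
  apply: (@dimv_leq_retract _ _ _ _ (fun u : RV => (rval u).1)
            (incl hmu H (V := V))).
  - by move=> a x y; rewrite rval_linear.
  - by move=> _ /memv_imgP[w _ ->]; rewrite rval_vop memv_img ?memvf.
  move=> _ /memv_imgP[w _ ->]; apply: inclK => j jJ.
  by rewrite (rep_vM RP1) ifN //; apply: contraNneq iJ => <-.
apply: (@dimv_leq_retract _ _ _ _ (incl hmu H (V := V))
          (fun u : RV => (rval u).1)).
- exact: incl_linear.
- by move=> _ /memv_imgP[v _ ->]; rewrite -vop_incl memv_img ?memvf.
move=> _ /memv_imgP[v _ ->]; rewrite rval_incl /= off_proj_vop.
by rewrite (negPf iJ).
Qed.

Definition star_proj (i : Q) (f : {ffun D -> V}) : {ffun D -> V} :=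
  [ffun b => if dhd b == i then vop V (dtl b) (f b) else 0].

Lemma star_proj_linear i : linear (star_proj i).
Proof.
move=> a x y; apply/ffunP=> b; rewrite !ffunE.
by case: ifP => _; rewrite ?linearP ?scaler0 ?addr0.
Qed.

(** The source of mu at i, namely the sum of the spaces at the tails of the arrows ending at i,
    realised as families vanishing on all other arrows. *)
Definition star_space i := limg (lfun_of (star_proj_linear i)).

Lemma star_spaceP i (f : {ffun D -> V}) :
  reflect (forall b, if dhd b == i then f b \in limg (vop V (dtl b))
                     else f b == 0) (f \in star_space i).
Proof.
apply: (iffP idP) => [/memv_imgP[g _ ->] b|fP].
  rewrite lfun_ofE ffunE; case: (dhd b == i) => //.
  by rewrite memv_img ?memvf.
apply/memv_imgP; exists f; rewrite ?memvf // lfun_ofE; apply/ffunP=> b.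
rewrite ffunE.
by have := fP b; case: ifP => _ => [/limg_vopP|/eqP].
Qed.

Definition star_sum (f : {ffun D -> V}) : V := \sum_b aop V b (f b).

Lemma star_sum_linear : linear star_sum.
Proof.
move=> a x y; rewrite /star_sum scaler_sumr -big_split; apply: eq_bigr => b _.
by rewrite !ffunE linearP.
Qed.

Lemma star_sum_img i : i \in J ->
  (lfun_of star_sum_linear @: star_space i)%VS = limg (vop V i).
Proof.
move=> iJ; apply/vspaceP=> v.
apply/memv_imgP/limg_vopP => [[f /star_spaceP fP ->]|vE].
  rewrite lfun_ofE linear_sum; apply: eq_bigr => b _ /=; rewrite (rep_va RP).
  by have := fP b; rewrite eq_sym; case: ifP => // _ /eqP ->; rewrite linear0.
(* The preimage is pi v / c, by mu pi = c. *)
exists [ffun b =>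
    if dhd b == i then c^-1 *: (sgn b *: aop V (dual b) v) else 0].
  apply/star_spaceP=> b; rewrite ffunE; case: (dhd b == i) => //.
  by apply/limg_vopP; rewrite !lfunZ (rep_va RP) dhd_dual eqxx.
rewrite lfun_ofE -[LHS]vE -[LHS]scale1r -(mulVf (refl_neq0 H)) -scalerA.
rewrite -(refl_lam H iJ) -(rep_rel RP) scaler_sumr [LHS]big_mkcond.
apply: eq_bigr => b _; rewrite ffunE (refl_lam H iJ).
by case: ifP => _; rewrite ?linear0 // !lfunZ.
Qed.

(** Rank-nullity for mu at i: its image is the old vertex space by [star_sum_img], and its kernel is
    identified with the new one. *)
Lemma dim_refl_on i : i \in J ->
  (\dim (limg (vop RV i)) + \dim (limg (vop V i)) =
   \sum_(b : D | dhd b == i) \dim (limg (vop V (dtl b))))%N.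
Proof.
move=> iJ; rewrite -(dim_ffun_space (star_spaceP i)).
rewrite -(limg_ker_dim (lfun_of star_sum_linear)) star_sum_img //; congr addn.
have Esp h : h \in (star_space i :&: lker (lfun_of star_sum_linear))%VS ->
    (0, h) \in rspace J V.
  move=> /memv_capP[/star_spaceP hP]; rewrite memv_ker lfun_ofE => /eqP h0.
  apply/refl_spaceP; split=> // [j jJ|b]; first exact: linear0.
  have := hP b; case: eqP => [->|_ /eqP ->].
    by rewrite iJ => /limg_vopP.
  by rewrite linear0 if_same.
apply/eqP; rewrite eqn_leq; apply/andP; split.
  apply: (@dimv_leq_retract _ _ _ _ (fun u : RV => (rval u).2)
            (fun h => rproj hmu H (0, h))).
  - by move=> a x y; rewrite rval_linear.
  - move=> u /memv_imgP[w _ uw]; have := rvalP w; have := rvalP u.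
    rewrite uw rval_vop; case: (rval w) => v h.
    move=> /refl_spaceP[_ _ e3] /refl_spaceP[_ e2 _].
    apply/memv_capP; split; last by rewrite memv_ker lfun_ofE; apply/eqP.
    apply/star_spaceP=> b; rewrite ffunE /=; case: eqP => // bi.
    by rewrite e2 bi iJ memv_img ?memvf.
  move=> u /memv_imgP[w _ uw]; apply: rval_inj.
  have e : rval u = (0, (rval u).2).
    rewrite uw rval_vop; congr (_, _).
    have := rvalP w; case: (rval w) => v h /refl_spaceP[e1 _ _].
    by rewrite /= e1.
  by rewrite rprojK -e ?rvalP.
apply: (@dimv_leq_retract _ _ _ _ (fun h => rproj hmu H (0, h))
          (fun u : RV => (rval u).2)).
- move=> a x y; rewrite -rproj_linear; congr rproj; congr (_, _).
  by rewrite /= scaler0 addr0.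
- move=> h hY; apply/memv_imgP; exists (rproj hmu H (0, h)); rewrite ?memvf //.
  apply: rval_inj; rewrite rval_vop rprojK ?Esp //; congr (_, _).
    by rewrite /= linear0.
  apply/ffunP=> b; rewrite ffunE /=.
  by have /memv_capP[/star_spaceP/(_ b)] := hY; case: ifP => // _ /eqP.
by move=> h hY; rewrite rprojK ?Esp.
Qed.

End Dimensions.

(** * Orbit reflections of dimension vectors and weights *)

Section ReflectionFormulas.
Variable Q : quiver.
Local Notation D := (arrow (double_quiver Q)).

Lemma sym_form_epsE (al : {ffun Q -> int}) (j : Q) :
  sym_form al (eps j) = al j *+ 2 - \sum_(b : D | dhd b == j) al (dtl b).
Proof.
have sumE : \sum_m al m * eps j m = al j.
  rewrite (bigD1 j) //= big1 => [|m mj]; rewrite !ffunE ?(negPf mj) ?mulr0 //.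
  by rewrite eqxx mulr1 addr0.
rewrite /sym_form /euler_form sumE.
under [X in _ + (X - _)]eq_bigr do rewrite mulrC.
rewrite sumE mulr2n big_sumType /= opprD addrACA; congr (_ + _).
rewrite -!opprD; congr (- (_ + _)).
  rewrite [RHS]big_mkcond; apply: eq_bigr => a _; rewrite ffunE /dhd /dtl /=.
  by case: (hd a == j); rewrite ?mulr0 ?mulr1.
rewrite [RHS]big_mkcond; apply: eq_bigr => a _; rewrite ffunE /dhd /dtl /=.
by case: (tl a == j); rewrite ?mul0r ?mul1r.
Qed.

Variables (G : {group quiver_aut Q}) (i : Q).
Hypotheses (hadm : admissible G) (hloop : loop_free i).
Local Notation J := (gorbit G i).

Lemma orbit_loop_free (a : arrow Q) : tl a \in J -> hd a != tl a.
Proof.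
move=> /imsetP[g Gg ta]; apply/eqP=> ha.
have tai : vact g^-1%g (tl a) = i by rewrite ta -vactM mulVg vact1.
by apply: (hloop (a := aact g^-1%g a)); rewrite tl_aact hd_aact ha tai.
Qed.

(** By admissibility an arrow inside the orbit would be a loop, and a group element would carry that
    loop to one at i. *)
Lemma orbit_arrow_free (a : arrow Q) : tl a \in J -> hd a \notin J.
Proof.
move=> ta; apply/negP=> ha; have := orbit_loop_free ta.
by rewrite (hadm (gorbit_trans ta ha)) eqxx.
Qed.

Lemma orbit_darrow_free (b : D) : dhd b \in J -> dtl b \notin J.
Proof.
case: b => a; rewrite /dhd /dtl /=; last exact: orbit_arrow_free.
by move=> ha; apply/negP=> /orbit_arrow_free; rewrite ha.
Qed.

(** Each reflection changes one coordinate in the orbit, using only coordinates at tails of arrows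
    into the orbit. Those tails lie outside it, so earlier reflections have not altered them. *)
Lemma orbit_vreflE (al : {ffun Q -> int}) m : orbit_vrefl G i al m =
  if m \in J then \sum_(b : D | dhd b == m) al (dtl b) - al m else al m.
Proof.
rewrite /orbit_vrefl -(mem_enum J); have := enum_uniq J.
have: {subset enum J <= J} by move=> x; rewrite mem_enum.
elim: (enum J) m => [|j s IH] m //= sO /andP[js us].
have jO : j \in J by apply: sO; rewrite mem_head.
have sO' : {subset s <= J} by move=> x xs; apply: sO; rewrite inE xs orbT.
rewrite ffunE sym_form_epsE !IH // (negPf js) ffunE inE.
have -> : \sum_(b : D | dhd b == j) foldr (@Defs.vrefl Q) al s (dtl b) =
    \sum_(b : D | dhd b == j) al (dtl b).
  apply: eq_bigr => b /eqP bj; rewrite IH // ifN //.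
  by apply: contra (orbit_darrow_free _); [apply: sO' | rewrite bj].
case: eqP => [->|_]; last by rewrite mulr0 subr0.
by rewrite (negPf js) mulr1 mulr2n opprB addrCA opprD addNKr.
Qed.

(** By [sym_form_epsE], the form of [eps j] and [eps m] is 2 if j = m and 0 otherwise, minus the
    number of double arrows from j to m. Outside the orbit this adds c = [lam i] for each arrow from
    it; at a vertex of the orbit no such arrow arrives, and c - 2 c = - c remains. *)
Lemma orbit_reflectable (k : fieldType) (lam : {ffun Q -> k}) :
    orbit_const G lam -> lam i != 0 ->
  reflectable G J (lam i) lam (orbit_lrefl G i lam).
Proof.
move=> hlam lam0; split=> //.
- by move=> g j; rewrite gorbit_act ?subgP.
- exact: orbit_darrow_free.
- by move=> j jJ; rewrite -(hlam i j).
move=> m; rewrite orbit_lreflE //.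
have -> : \sum_(j in J) (sym_form (eps j) (eps m))%:~R * lam j =
    (if m \in J then lam i *+ 2 else 0) -
    \sum_(b : D | (dhd b == m) && (dtl b \in J)) lam i.
  transitivity (\sum_(j in J) (if m == j then lam i *+ 2 else 0) -
      \sum_(j in J) \sum_(b : D | dhd b == m)
        (if dtl b == j then lam i else 0)).
    rewrite -sumrB; apply: eq_bigr => j jJ; rewrite -(hlam i j) //.
    rewrite sym_form_epsE rmorphB rmorphMn rmorph_sum /= mulrBl mulr_suml.
    rewrite ffunE; congr (_ - _).
      by case: eqP => _; rewrite ?mul0rn ?mul0r // mulrnAl mul1r.
    apply: eq_bigr => b _; rewrite ffunE.
    by case: eqP => _; rewrite ?mul1r ?mul0r.
  congr (_ - _).
    rewrite -big_mkcondr; case: ifP => mJ.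
      rewrite (big_pred1 m) // => j; rewrite /= eq_sym.
      by apply: andb_idl => /eqP ->.
    by rewrite big_pred0 // => j; case: eqP => [<-|_]; rewrite ?mJ ?andbF.
  rewrite exchange_big /= [RHS]big_mkcondr; apply: eq_bigr => b _.
  rewrite -big_mkcondr; case: ifP => bJ.
    rewrite (big_pred1 (dtl b)) // => j; rewrite /= eq_sym.
    by apply: andb_idl => /eqP ->.
  by rewrite big_pred0 // => j; case: eqP => [<-|_]; rewrite ?bJ ?andbF.
case: ifP => mJ; last by rewrite sub0r opprK.
rewrite big_pred0 => [|b]; last first.
  by case: eqP => //= bm; apply/negbTE/orbit_darrow_free; rewrite bm.
by rewrite subr0 -(hlam i m) // mulr2n opprD addrA subrr sub0r.
Qed.

End ReflectionFormulas.

Theorem theorem1p3 (k : closedFieldType) (Q : quiver)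
    (G : {group quiver_aut Q}) (hchar : [pchar k]^'.-nat #|G|)
    (lam : {ffun Q -> k}) (hlam : orbit_const G lam)
    (i : Q) (hloop : loop_free i) (hlami : lam i != 0)
    (hab : abelian G) (hadm : admissible G) :
  exists F : functor (fdmod_cat (preproj_skew hlam))
                     (fdmod_cat (preproj_skew (orbit_lrefl_const i hadm hlam))),
    is_equivalence F /\
    forall V : fdmod (preproj_skew hlam),
      dimvec (F V) = orbit_vrefl G i (dimvec V).
Proof.
have H := orbit_reflectable hadm hloop hlam hlami.
exists (reflection hlam _ H); split; first exact: reflection_equivalence.
move=> V; apply/ffunP=> m; rewrite orbit_vreflE // !ffunE.
have dimE (mu : {ffun Q -> k}) (hmu : orbit_const G mu)
    (W : fdmod (preproj_skew hmu)) j :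
    fd_act W (preproj_skew_idem hmu j) = vop W j by rewrite vop.unlock.
rewrite !dimE; case: ifP => mJ; last by rewrite (dim_refl_off _ H) ?mJ.
under eq_bigr do rewrite ffunE dimE.
rewrite -(big_morph Posz PoszD (erefl _)).
rewrite -(dim_refl_on (orbit_lrefl_const i hadm hlam) H V mJ) PoszD addrK //.
Qed.
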